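(* Let $\Lambda\subseteq\mathbb{R}^d$ and suppose there are a cut-and-project scheme $(\mathbb{R}^d,H,\mathcal{L})$, a point $x\in\mathbb{R}^d\times H$, a non-empty open $U\subseteq H$ and a compact $W\subseteq H$ with $U\subseteq W$ such that $\Lambda_U(x)\subseteq\Lambda\subseteq\Lambda_W(x)$. Then there exist a cut-and-project scheme $(\mathbb{R}^d,H',\mathcal{L}')$ with second countable $H'$ and injective $\star$-map, and a relatively compact Borel measurable set $W'\subseteq H'$ with non-empty interior, such that $\Lambda=\pi^{\mathbb{R}^d}(\mathcal{L}'\cap(\mathbb{R}^d\times W'))$; i.e. $\Lambda$ is a model set. If moreover $W\setminus U$ has Haar measure zero, then $W'$ can be chosen measure-theoretically regular, so that $\Lambda$ is a regular model set. In particular, every translate of an inter model set in $\mathbb{R}^d$ is a model set, and every translate of an inter regular model set in $\mathbb{R}^d$ is a regular model set.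
   Context: A cut-and-project scheme $(G,H,\mathcal{L})$ consists of locally compact abelian groups $G,H$ and a discrete cocompact subgroup $\mathcal{L}\subseteq G\times H$ such that $\pi^G|_{\mathcal{L}}$ is injective and $\pi^H(\mathcal{L})$ is dense in $H$. The $\star$-map is $x^\star=\pi^H((\pi^G|_{\mathcal{L}})^{-1}(x))$ on $\pi^G(\mathcal{L})$; it is injective if $\pi^H|_{\mathcal L}$ is injective. For $W\subseteq H$ and $x\in G\times H$, $\Lambda_W(x)=\pi^G((x+\mathcal{L})\cap(G\times W))$ and $\Lambda_W=\Lambda_W(0)$. A model set is a set $\Lambda_W$ (in some cut-and-project scheme) with $W$ relatively compact, Borel measurable, with non-empty interior; it is a regular model set if in addition $\partial W=\overline W\setminus W^\circ$ has Haar measure zero (measure-theoretic regularity). An inter (regular) model set is a set $\Gamma\subseteq G$ with $\Lambda_{W^\circ}\subseteq\Gamma\subseteq\Lambda_{\overline W}$ for some cut-and-project scheme and some window $W$ as in the definition of a (regular) model set. *)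

(* Defs.v *)
From HB Require Import structures.
From mathcomp Require Import all_boot all_order all_algebra.
From mathcomp Require Import all_classical all_reals all_analysis.

Set Implicit Arguments.
Unset Strict Implicit.
Unset Printing Implicit Defensive.

Import Order.TTheory GRing.Theory Num.Theory.
Local Open Scope classical_set_scope.
Local Open Scope ring_scope.

Definition LCA (H : topologicalZmodType) : Prop :=
  hausdorff_space H /\ locally_compact [set: H].

Definition Borel (H : topologicalType) (A : set H) : Prop := <<s @open H >> A.

Section BorelSpace.
Variable H : topologicalZmodType.
Definition pointed_of : Type := H.
HB.instance Definition _ := Choice.on pointed_of.
HB.instance Definition _ := isPointed.Build pointed_of (0 : H).
Definition borel_space := @g_sigma_algebraType pointed_of (@open H).
End BorelSpace.

Definition Haar_measure (R : realType) (H : topologicalZmodType)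
  (mu : {measure set (borel_space H) -> \bar R}) : Prop :=
  [/\ mu [set: H] != 0%E,
      (forall (t : H) (A : set H), Borel A ->
          mu [set t + a | a in A] = mu A),
      (forall K : set H, compact K -> (mu K < +oo)%E),
      (forall A : set H, Borel A ->
          mu A = ereal_inf [set mu V | V in [set V : set H | open V /\ A `<=` V]]) &
      (forall V : set H, open V ->
          mu V = ereal_sup [set mu K | K in [set K : set H | compact K /\ K `<=` V]])].

(** A set has Haar measure zero (w.r.t. the Haar measure, unique up to a
    positive constant). *)
Definition Haar_null (R : realType) (H : topologicalZmodType) (A : set H) : Prop :=
  exists mu : {measure set (borel_space H) -> \bar R},
    Haar_measure mu /\ mu A = 0%E.

(** Cut-and-project scheme (G, H, L), L a subset of G x H.
    Cocompactness of L is expressed as: some compact K satisfies K + L = G x H. *)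
Definition cut_and_project (G H : topologicalZmodType) (L : set (G * H)) : Prop :=
  LCA G /\ LCA H /\
  (L (0, 0) /\ (forall a b, L a -> L b -> L (a.1 - b.1, a.2 - b.2))) /\
  (forall l, L l -> exists N : set (G * H), nbhs l N /\ N `&` L = [set l]) /\
  (exists K : set (G * H), compact K /\
     forall z : G * H, exists k l, K k /\ L l /\ z = (k.1 + l.1, k.2 + l.2)) /\
  (forall a b, L a -> L b -> a.1 = b.1 -> a = b) /\
  dense [set l.2 | l in L].

Definition star_injective (G H : topologicalZmodType) (L : set (G * H)) : Prop :=
  forall a b, L a -> L b -> a.2 = b.2 -> a = b.

Definition Lambda (G H : topologicalZmodType) (L : set (G * H)) (W : set H)
  (x : G * H) : set G :=
  [set x.1 + l.1 | l in [set l | L l /\ W (x.2 + l.2)]].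

Definition model_window (H : topologicalZmodType) (W : set H) : Prop :=
  [/\ precompact W, Borel W & W° !=set0].

Definition regular_window (R : realType) (H : topologicalZmodType) (W : set H) : Prop :=
  model_window W /\ Haar_null R (closure W `\` W°).

Definition is_model_set (G : topologicalZmodType) (Gam : set G) : Prop :=
  exists (H : topologicalZmodType) (L : set (G * H)) (W : set H),
    [/\ cut_and_project L, model_window W & Gam = Lambda L W (0, 0)].

Definition is_regular_model_set (R : realType) (G : topologicalZmodType)
  (Gam : set G) : Prop :=
  exists (H : topologicalZmodType) (L : set (G * H)) (W : set H),
    [/\ cut_and_project L, regular_window R W & Gam = Lambda L W (0, 0)].

Definition is_inter_model_set (G : topologicalZmodType) (Gam : set G) : Prop :=
  exists (H : topologicalZmodType) (L : set (G * H)) (W : set H),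
    [/\ cut_and_project L, model_window W,
        Lambda L W° (0, 0) `<=` Gam & Gam `<=` Lambda L (closure W) (0, 0)].

Definition is_inter_regular_model_set (R : realType) (G : topologicalZmodType)
  (Gam : set G) : Prop :=
  exists (H : topologicalZmodType) (L : set (G * H)) (W : set H),
    [/\ cut_and_project L, regular_window R W,
        Lambda L W° (0, 0) `<=` Gam & Gam `<=` Lambda L (closure W) (0, 0)].

(* Main.v *)
Require Import Defs.
From HB Require Import structures.
From mathcomp Require Import all_boot all_order all_algebra.
From mathcomp Require Import all_classical all_reals all_analysis.
From mathcomp Require Import measurable_realfun zify ring lra.

Set Implicit Arguments.
Unset Strict Implicit.
Unset Printing Implicit Defensive.

Import Order.TTheory GRing.Theory Num.Theory.
Import numFieldNormedType.Exports.
Local Open Scope classical_set_scope.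
Local Open Scope ring_scope.

(** Write [t] for the first coordinate of [x] and translate the windows so that
    the second coordinate of [x] is [0]. Let [H0] be a sigma-compact open
    subgroup of [H] containing the windows and the projection of a compact set
    meeting every coset of [L], let [V_n] be a shrinking sequence of
    neighbourhoods of [0] with [V_(n+1) + V_(n+1) <= V_n], and let [K0] be their
    intersection. The new internal group is the quotient [E] of
    [H0 * int * R] by the triples [(h, n, r)] with [r] a period and
    [h - l.2] in [K0] for some [l] in [L] with [l.1 + n t = 0]: the factor [int]
    adjoins [t] to the projection of [L]; dividing by [K0] makes [E] second
    countable; the factor [R], in which the periods are [int], or all of [R] if
    the star map is already injective modulo [K0], carries a generic linear form
    [chi] that makes the star map injective, and its image stays dense because an
    irrational rotation has dense orbits. The new lattice consists of the [(g, (l.2, n, chi g))] with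
    [g = l.1 + n t]. The new window is the image of the points of [U] that stay
    in [U] under some [V_n], together with the countably many star images of
    points of [Lam]; its boundary lies between the images of [U] and [W], and the
    [V_n] can be chosen such that nothing but null sets is lost. The Haar measure
    of [E] is built from that of [H] and Lebesgue measure on [[0, 1)] on the open
    subgroup of the classes of [(h, 0, r)], and extended by summation over its
    cosets. *)

(** * Topological subquotients *)

(** The data of a topological group [S / N]. The group [V] itself carries no topology: the images of
    the sets [B n] are to be a base of the neighbourhoods of 0, which allows a topology coarser than
    the given one. *)
Record subquotient (V : zmodType) := Subquotient {
  sq_S : set V;
  sq_N : set V;
  sq_B : nat -> set V;
  sq_S0 : sq_S 0;
  sq_SB : forall u v, sq_S u -> sq_S v -> sq_S (u - v);
  sq_N0 : sq_N 0;
  sq_NB : forall u v, sq_N u -> sq_N v -> sq_N (u - v);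
  sq_NS : sq_N `<=` sq_S;
  sq_BS : forall n, sq_B n `<=` sq_S;
  sq_B0 : forall n, sq_B n 0;
  sq_BN : forall n v, sq_B n v -> sq_B n (- v);
  sq_BD : forall n u v, sq_B n.+1 u -> sq_B n.+1 v -> sq_B n (u + v) }.

Section Subquotient.
Context {V : zmodType} (D : subquotient V).
Local Notation S := (sq_S D).
Local Notation N := (sq_N D).
Local Notation B := (sq_B D).
Implicit Types u v w : V.

Let NN v : N v -> N (- v).
Proof. by move=> Nv; rewrite -[- v]add0r; apply: sq_NB => //; exact: sq_N0. Qed.

Let ND u v : N u -> N v -> N (u + v).
Proof. by move=> Nu Nv; rewrite -[v]opprK; apply: sq_NB => //; exact: NN. Qed.

Let SN v : S v -> S (- v).
Proof. by move=> Sv; rewrite -[- v]add0r; apply: sq_SB => //; exact: sq_S0. Qed.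

Let SD u v : S u -> S v -> S (u + v).
Proof. by move=> Su Sv; rewrite -[v]opprK; apply: sq_SB => //; exact: SN. Qed.

Definition sq_rep v := xget 0 [set w | S w /\ N (v - w)].

Let rep_spec v : S v -> S (sq_rep v) /\ N (v - sq_rep v).
Proof.
move=> Sv; rewrite /sq_rep; case: xgetP => [w _ //|/(_ v) []].
by split=> //; rewrite subrr; exact: sq_N0.
Qed.

Let rep_eq u v : N (u - v) -> sq_rep u = sq_rep v.
Proof.
move=> Nuv; rewrite /sq_rep; congr xget; apply/seteqP; split=> w /= [Sw Nw]; split=> //.
  have -> : v - w = (u - w) - (u - v) by rewrite opprB [RHS]addrC addrA subrK.
  exact: sq_NB.
have -> : u - w = (u - v) + (v - w) by rewrite addrA subrK.
exact: ND.
Qed.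

Let rep_idem v : S v -> sq_rep (sq_rep v) = sq_rep v.
Proof.
by move=> Sv; apply: rep_eq; rewrite -opprB; apply: NN; apply: (rep_spec Sv).2.
Qed.

(** The quotient is realized as the subtype of chosen representatives: [xget] depends only on the
    predicate, hence [sq_rep] only on the coset. *)
Definition sq_canonical v : bool := `[< S v /\ sq_rep v = v >].

Definition sq_type : Type := {v : V | sq_canonical v}.
HB.instance Definition _ := Choice.on sq_type.

Let rep_canonical v : S v -> sq_canonical (sq_rep v).
Proof. by move=> Sv; apply/asboolP; split; [exact: (rep_spec Sv).1|exact: rep_idem]. Qed.

Definition sq_proj v : sq_type :=
  match pselect (S v) with
  | left Sv => exist _ (sq_rep v) (rep_canonical Sv)
  | right _ => exist _ (sq_rep 0) (rep_canonical (sq_S0 D))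
  end.

Let val_proj v : S v -> \val (sq_proj v) = sq_rep v.
Proof. by rewrite /sq_proj; case: pselect. Qed.

Let S_val (e : sq_type) : S (\val e).
Proof. by case: e => v /= /asboolP []. Qed.

Let proj_val (e : sq_type) : sq_proj (\val e) = e.
Proof.
apply: val_inj; rewrite val_proj; last exact: S_val.
by case: e => v /= /asboolP [].
Qed.

Let proj_eq u v : S u -> S v -> sq_proj u = sq_proj v <-> N (u - v).
Proof.
move=> Su Sv; split=> [/(congr1 val)|Nuv].
  rewrite !val_proj// => e.
  have -> : u - v = (u - sq_rep u) - (v - sq_rep v).
    by rewrite e opprB addrA subrK.
  by apply: sq_NB; [exact: (rep_spec Su).2|exact: (rep_spec Sv).2].
by apply: val_inj; rewrite !val_proj//; exact: rep_eq.
Qed.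

Definition sq_zero := sq_proj 0.
Definition sq_opp (a : sq_type) := sq_proj (- \val a).
Definition sq_add (a b : sq_type) := sq_proj (\val a + \val b).

Let val_N v : S v -> N (v - \val (sq_proj v)).
Proof. by move=> Sv; rewrite val_proj//; exact: (rep_spec Sv).2. Qed.

Let proj_add u v : S u -> S v -> sq_add (sq_proj u) (sq_proj v) = sq_proj (u + v).
Proof.
move=> Su Sv; apply/proj_eq; try by apply: SD => //; exact: S_val.
by rewrite opprD addrACA -!(opprB u) -(opprB v) -opprD; apply/NN/ND; exact: val_N.
Qed.

Let proj_opp u : S u -> sq_opp (sq_proj u) = sq_proj (- u).
Proof.
move=> Su; apply/proj_eq; try by apply: SN => //; exact: S_val.
by rewrite opprK addrC; exact: val_N.
Qed.

Let sq_addA : associative sq_add.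
Proof.
move=> a b c; rewrite -(proj_val a) -(proj_val b) -(proj_val c).
by rewrite !proj_add ?addrA //; try apply: SD; exact: S_val.
Qed.

Let sq_addC : commutative sq_add.
Proof. by move=> a b; rewrite /sq_add addrC. Qed.

Let sq_add0 : left_id sq_zero sq_add.
Proof.
move=> a; by rewrite -(proj_val a) proj_add ?add0r//; do ?[exact: sq_S0|exact: S_val].
Qed.

Let sq_addN : left_inverse sq_zero sq_opp sq_add.
Proof.
move=> a; rewrite -(proj_val a) proj_opp; last exact: S_val.
by rewrite proj_add ?addNr//; do ?[apply: SN]; exact: S_val.
Qed.

HB.instance Definition _ := GRing.isZmodule.Build sq_type sq_addA sq_addC sq_add0 sq_addN.

Let projD u v : S u -> S v -> sq_proj (u + v) = sq_proj u + sq_proj v.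
Proof. by move=> Su Sv; rewrite -proj_add. Qed.

Let projN u : S u -> sq_proj (- u) = - sq_proj u.
Proof. by move=> Su; rewrite -proj_opp. Qed.

Definition sq_nbhs (e : sq_type) : set_system sq_type :=
  [set A | exists n, forall v, B n v -> A (e + sq_proj v)].

HB.instance Definition _ := hasNbhs.Build sq_type sq_nbhs.

Let B_decr n m : (n <= m)%N -> B m `<=` B n.
Proof.
move/subnK <-; elim: (m - n)%N => [|k IH] // v Bv; apply: IH.
by rewrite -[v]addr0; apply: sq_BD => //; exact: sq_B0.
Qed.

Let nbhs_filter_ (e : sq_type) : ProperFilter (nbhs e).
Proof.
split; first by move=> [n /(_ 0 (sq_B0 D n))].
split; first by exists 0%N.
- move=> P Q [n Pn] [m Qm]; exists (maxn n m) => v Bv; split.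
    by apply: Pn; apply: B_decr Bv; exact: leq_maxl.
  by apply: Qm; apply: B_decr Bv; exact: leq_maxr.
- by move=> P Q PQ [n Pn]; exists n => v Bv; apply: PQ; exact: Pn.
Qed.

Let proj0 : sq_proj 0 = 0. Proof. by []. Qed.

Let nbhs_singleton_ (e : sq_type) (A : set sq_type) : nbhs e A -> A e.
Proof. by move=> [n /(_ 0 (sq_B0 D n))]; rewrite proj0 addr0. Qed.

Let nbhs_nbhs_ (e : sq_type) (A : set sq_type) : nbhs e A -> nbhs e (nbhs^~ A).
Proof.
move=> [n An]; exists n.+1 => v Bv; exists n.+1 => w Bw.
rewrite -addrA -projD; [|exact: sq_BS Bv|exact: sq_BS Bw].
by apply: An; exact: sq_BD.
Qed.

HB.instance Definition _ := Nbhs_isNbhsTopological.Build sq_type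
  nbhs_filter_ nbhs_singleton_ nbhs_nbhs_.

Let sub_continuous_ : continuous (fun x : sq_type * sq_type => x.1 - x.2).
Proof.
move=> [a b] A [n An] /=.
exists ([set a + sq_proj v | v in B n.+1], [set b + sq_proj v | v in B n.+1]) => /=.
  by split; exists n.+1 => v Bv; exists v.
move=> [_ _] /= [[u Bu <-] [v Bv <-]].
have -> : a + sq_proj u - (b + sq_proj v) = a - b + sq_proj (u - v).
  rewrite projD ?projN//; [|exact: sq_BS Bv|exact: sq_BS Bu|].
    by rewrite opprD addrACA.
  by apply: SN; exact: sq_BS Bv.
by apply: An; apply: sq_BD => //; exact: sq_BN.
Qed.

HB.instance Definition _ :=
  PreTopologicalNmodule_isTopologicalZmodule.Build sq_type sub_continuous_.

(** The hypothesis says that [N] is closed, being the intersection of the sets [N + B n]. If all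
    neighbourhoods of two points meet, their difference lies in each [N + B n], so it vanishes
    modulo [N]. *)
Lemma subquotient_topology :
  (forall v, (forall n, exists2 u, B n u & N (v - u)) -> N v) ->
  exists (E : topologicalZmodType) (p : V -> E),
    [/\ hausdorff_space E,
        forall u v, S u -> S v -> p (u + v) = p u + p v,
        forall e, exists2 v, S v & p v = e,
        forall u v, S u -> S v -> p u = p v <-> N (u - v) &
        forall A, nbhs (0 : E) A <-> exists n, forall v, B n v -> A (p v)].
Proof.
move=> sep; exists sq_type, sq_proj; split.
- move=> a b ab.
  rewrite -(proj_val a) -(proj_val b); apply/proj_eq; try exact: S_val.
  rewrite -opprB; apply/NN/sep => n.
  have [z [] [u Bu <-] [v Bv]] : [set a + sq_proj v | v in B n.+1] `&` [set b + sq_proj v | v in B n.+1] !=set0.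
    by apply: ab; exists n.+1 => v Bv; exists v.
  move=> e.
  exists (u - v); first by apply: sq_BD => //; exact: sq_BN.
  have Su : S u by exact: sq_BS Bu.
  have Sv : S v by exact: sq_BS Bv.
  apply/proj_eq; first by apply: sq_SB; exact: S_val.
    exact: sq_SB.
  rewrite !projD ?projN ?proj_val//; try apply: SN => //; try exact: S_val.
  by apply/eqP; rewrite subr_eq addrAC (addrC _ a) -e addrK.
- by move=> u v Su Sv; exact (projD Su Sv).
- by move=> e; exists (\val e); [exact: S_val|exact: proj_val].
- exact: proj_eq.
- by move=> A; split=> -[n An]; exists n => v Bv; have := An v Bv; rewrite add0r.
Qed.

End Subquotient.


(** * Regularity of Borel measures *)

Lemma compact_finite_cover (T : topologicalType) (I : choiceType) (C : set T)
    (O : I -> set T) : compact C -> (forall i, open (O i)) ->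
  C `<=` \bigcup_i O i -> exists s : seq I, forall x, C x -> exists2 i, i \in s & O i x.
Proof.
move=> cC oO CO; have [->|/set0P [x0 _]] := eqVneq C set0; first by exists [::].
(* The covering form of compactness is stated for pointed spaces; [x0] serves as base point. *)
pose pT : ptopologicalType := HB.pack (T : Type) (Topological.on T) (isPointed.Build T x0).
have : @cover_compact pT C by rewrite -compact_cover.
move=> /(_ I setT O (fun i _ => oO i)) [//|s _ sC].
by exists (finmap.enum_fset s) => x /sC [i /= si Oi]; exists i.
Qed.

Lemma open_borel (H : topologicalZmodType) (A : set H) :
  open A -> measurable (A : set (borel_space H)).
Proof. by move=> oA; exact: sub_sigma_algebra. Qed.

Lemma closed_borel (H : topologicalZmodType) (A : set H) :
  closed A -> measurable (A : set (borel_space H)).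
Proof.
by move=> cA; rewrite -[A]setCK; apply: measurableC; apply: open_borel; rewrite openC.
Qed.

Section Regularity.
Local Open Scope ereal_scope.
Context {R : realType} {E : topologicalZmodType}.
Variables (b c : nat -> set E).
Hypothesis (b_open : forall i, open (b i)).
Hypothesis (c_compact : forall i, compact (c i)).
Hypothesis (hE : hausdorff_space E).
Hypothesis (bc : forall i, b i `<=` c i).
Hypothesis (b_basis : forall O x, open O -> O x -> exists2 i, b i x & c i `<=` O).

Let c_closed i : closed (c i).
Proof. exact: compact_closed. Qed.

(** For open [O] this is an increasing exhaustion by compact sets: by [b_basis] every point of [O]
    lies in some [c i] contained in [O]. *)
Let cpart O n : set E := \big[setU/set0]_(i < n | `[< c i `<=` O >]) c i.

Let cpart_compact O n : compact (cpart O n).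
Proof. exact: bigsetU_compact. Qed.

Let cpart_closed O n : closed (cpart O n).
Proof. by apply: compact_closed => //; exact: cpart_compact. Qed.

Let cpart_sub O n : cpart O n `<=` O.
Proof.
by rewrite /cpart -bigcup_seq_cond => x [i /=] /andP[_ /asboolP cO] /cO.
Qed.

Let cpart_homo O n m : (n <= m)%N -> cpart O n `<=` cpart O m.
Proof.
move=> nm; rewrite /cpart -!(big_mkord (fun i => `[< c i `<=` O >]) c).
by rewrite -!bigcup_seq_cond => x [i /=]; rewrite !mem_index_iota => /andP[/andP[_ im] ci] cx;
  exists i => //=; rewrite !mem_index_iota (leq_trans im nm).
Qed.

Let cpart_bigcup O : open O -> \bigcup_n cpart O n = O.
Proof.
move=> oO; apply/seteqP; split=> [x [n _]|x Ox]; first exact: cpart_sub.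
have [i bx cO] := b_basis oO Ox; exists i.+1 => //.
rewrite /cpart -(big_mkord (fun i => `[< c i `<=` O >]) c) -bigcup_seq_cond.
exists i; last exact: bc.
by rewrite /= mem_index_iota /= ltnSn; apply/asboolP.
Qed.

Let cpart_measurable O n : measurable (cpart O n : set (borel_space E)).
Proof. by apply: closed_borel; exact: cpart_closed. Qed.

Let cpart_cvg (m : {measure set (borel_space E) -> \bar R}) O : open O ->
  m (cpart O n) @[n --> \oo] --> m O.
Proof.
move=> oO; rewrite -[in X in _ --> X](cpart_bigcup oO).
apply: nondecreasing_cvg_mu => //; last by move=> n k nk; apply/subsetPset; exact: cpart_homo.
by rewrite cpart_bigcup//; exact: open_borel.
Qed.

Lemma open_inner_regular (m : {measure set (borel_space E) -> \bar R}) (O : set E) :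
  open O -> m O = ereal_sup [set m K | K in [set K : set E | compact K /\ K `<=` O]].
Proof.
move=> oO; apply/eqP; rewrite eq_le; apply/andP; split; last first.
  apply: ge_ereal_sup => _ [K [cK KO] <-].
  apply: le_measure; rewrite ?inE//; last exact: open_borel.
  by apply: closed_borel; exact: compact_closed.
have cv := @cpart_cvg m O oO.
rewrite -(cvg_lim _ cv)//; apply: lime_le; first by apply/cvg_ex; eexists; exact: cv.
by apply: nearW => n; apply: ereal_sup_ubound; exists (cpart O n).
Qed.

Let approx (m : set E -> \bar R) (A : set E) := forall e : R, (0 < e)%R ->
  exists F O : set E, [/\ closed F, open O, F `<=` A, A `<=` O & m (O `\` F) < e%:E].

(** Complements exchange the closed and the open set. In a countable union the open sets can be
    united, but only finite unions of the closed ones are closed; as [m] is finite, continuity from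
    above shows that a finite union suffices. *)
Let approx_sigma_algebra (m : {measure set (borel_space E) -> \bar R}) :
  m setT < +oo -> sigma_algebra setT (approx m).
Proof.
move=> mT; have meas0 : m set0 = 0 by exact: measure0.
have mO F O : closed F -> open O -> measurable (O `\` F : set (borel_space E)).
  by move=> cF oO; apply: measurableD; [exact: open_borel|exact: closed_borel].
split.
- move=> e e0; exists set0, set0; split=> //; first exact: closed0.
    exact: open0.
  by rewrite setD0 meas0 lte_fin.
- move=> A aA e e0; have [F [P [cF oP FA AP mFP]]] := aA e e0.
  exists (~` P), (~` F); rewrite !setTD; split.
  + by rewrite closedC.
  + by rewrite openC.
  + exact: subsetC.
  + exact: subsetC.
  + by rewrite setDE setCK setIC -setDE.
- move=> A aA e e0.
  (* The errors add up to [e / 2], so that the inequality for the limit is strict. *)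
  have /choice[FO FOP] : forall k, exists FO : set E * set E,
      [/\ closed FO.1, open FO.2, FO.1 `<=` A k, A k `<=` FO.2 &
          m (FO.2 `\` FO.1) < (e / 2 / (2 ^ k.+1)%:R)%:E].
    move=> k; have [|F [P FP]] := aA k (e / 2 / (2 ^ k.+1)%:R)%R; last by exists (F, P).
    by rewrite !divr_gt0// ltr0n expn_gt0.
  pose O := \bigcup_k (FO k).2.
  pose F n := \big[setU/set0]_(k < n) (FO k).1.
  have oO : open O by apply: bigcup_open => k _; have [] := FOP k.
  have cF n : closed (F n).
    by apply: closed_bigsetU => k _; have [] := FOP k.
  have FE n : F n = \bigcup_(k in [set k | (k < n)%N]) (FO k).1 by rewrite bigcup_mkord.
  pose G n := O `\` F n.
  have Gcv : m (G n) @[n --> \oo] --> m (\bigcap_n G n).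
    apply: nonincreasing_cvg_mu => //.
    + apply: le_lt_trans mT; apply: le_measure; rewrite ?inE//; exact: mO.
    + by move=> n; exact: mO.
    + by apply: bigcap_measurable => // n _; exact: mO.
    + move=> n k nk; apply/subsetPset; apply: setDS; rewrite !FE.
      by apply: bigcup_sub => i /= ink x Fx; exists i => //=; exact: leq_trans nk.
  have Gm : m (\bigcap_n G n) < e%:E.
    apply: (@le_lt_trans _ _ (e / 2)%:E); last by rewrite lte_fin gtr_pMr// invf_lt1// ltr1n.
    have ltr0Sn2 : (0 < 2 :> R)%R by [].
    apply: (le_trans _ (epsilon_trick0 xpredT (ltW (divr_gt0 e0 ltr0Sn2)))).
    apply: (@le_trans _ _ (\sum_(0 <= k <oo) m ((FO k).2 `\` (FO k).1))).
      apply: measure_sigma_subadditive.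
      * by move=> k; have [? ? _ _ _] := FOP k; exact: mO.
      * by apply: bigcap_measurable => // n _; exact: mO.
      * move=> x Gx; have [[k _ Ox] _] := Gx 0%N I; exists k => //; split=> //.
        by move=> Fx; have [_] := Gx k.+1 I; apply; rewrite FE; exists k => /=.
    apply: lee_nneseries => // k _; have [_ _ _ _ ?] := FOP k; exact: ltW.
  have [n Hn] : exists n, m (G n) < e%:E.
    have [N _ HN] := Gcv _ (open_nbhs_nbhs (conj (@open_ereal_lt_ereal _ e%:E) Gm)).
    by exists N; exact: HN (leqnn N).
  exists (F n), O; split=> //.
    by rewrite FE => x [k /= _ Fx]; exists k => //; have [_ _ FA _ _] := FOP k; exact: FA.
  by apply: subset_bigcup => k _; have [] := FOP k.
Qed.


Let approx_open (m : {measure set (borel_space E) -> \bar R}) (O : set E) :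
  m setT < +oo -> open O -> approx m O.
Proof.
move=> mT oO e e0.
have mO n : measurable (O `\` cpart O n : set (borel_space E)).
  by apply: measurableD; [exact: open_borel|exact: cpart_measurable].
have Gcv : m (O `\` cpart O n) @[n --> \oo] --> m (\bigcap_n (O `\` cpart O n)).
  apply: nonincreasing_cvg_mu => //.
  - by apply: le_lt_trans mT; apply: le_measure; rewrite ?inE.
  - by apply: bigcap_measurable => // n _; exact: mO.
  - by move=> n k nk; apply/subsetPset; apply: setDS; exact: cpart_homo.
have G0 : m (\bigcap_n (O `\` cpart O n)) < e%:E.
  rewrite (_ : \bigcap_n _ = set0) ?measure0 ?lte_fin//.
  rewrite -subset0 => x Gx; have [Ox _] := Gx 0%N I.
  move: (Ox); rewrite -(cpart_bigcup oO) => -[n _ cx].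
  by have [_] := Gx n I; apply.
have [N _ HN] := Gcv _ (open_nbhs_nbhs (conj (@open_ereal_lt_ereal _ e%:E) G0)).
exists (cpart O N), O; split=> //; exact: HN (leqnn N).
Qed.

Lemma borel_approx (m : {measure set (borel_space E) -> \bar R}) (A : set E) (e : R) :
    m setT < +oo -> Borel A -> (0 < e)%R ->
  exists O : set E, [/\ open O, A `<=` O & m (O `\` A) < e%:E].
Proof.
move=> mT bA e0.
have aA : approx m A.
  move: A bA; apply: smallest_sub; first exact: approx_sigma_algebra.
  by move=> P oP; exact: approx_open.
have [F [P [cF oP FA AP mPF]]] := aA e e0.
exists P; split=> //; apply: le_lt_trans mPF; apply: le_measure; rewrite ?inE//.
- by apply: measurableD => //; exact: open_borel.
- by apply: measurableD; [exact: open_borel|exact: closed_borel].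
- exact: setDS.
Qed.

(** The measure may be infinite, but its restriction to [b i] is finite because [b i] lies in the
    compact [c i]. There [A] is approximated with error [e / 2 ^ i.+1], and the open sets, cut down
    to [b i], are united. *)
Lemma borel_outer_regular (m : {measure set (borel_space E) -> \bar R}) (A : set E) :
    (forall K : set E, compact K -> m K < +oo) -> Borel A ->
  m A = ereal_inf [set m V | V in [set V : set E | open V /\ A `<=` V]].
Proof.
move=> mfin bA; apply/eqP; rewrite eq_le; apply/andP; split.
  apply: le_ereal_inf_tmp => _ [V [oV AV] <-].
  by apply: le_measure; rewrite ?inE//; exact: open_borel.
have [mA|] := ltP (m A) +oo; last by rewrite leye_eq => /eqP ->; rewrite leey.
have mb i : measurable (b i : set (borel_space E)) by exact: open_borel.
apply/lee_addgt0Pr => e e0.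
have /choice[P HP] : forall i, exists O : set E,
    [/\ open O, A `<=` O & m ((O `\` A) `&` b i) < (e / (2 ^ i.+1)%:R)%:E].
  move=> i; apply: (@borel_approx (mrestr m (mb i))) => //.
    rewrite /=; apply: (@le_lt_trans _ _ (m (c i))); last exact: mfin.
    rewrite /mrestr; apply: le_measure; rewrite ?inE; last by move=> x [_ /bc].
      exact: measurableI.
    by apply: closed_borel; exact: c_closed.
  by rewrite divr_gt0// ltr0n expn_gt0.
pose V := \bigcup_i (P i `&` b i).
have oV : open V by apply: bigcup_open => i _; apply: openI => //; have [] := HP i.
have AV : A `<=` V.
  move=> x Ax; have [i bx _] := b_basis openT (I : setT x).
  by exists i => //; split=> //; have [_ AO _] := HP i; exact: AO.
have mV : measurable (V : set (borel_space E)) by exact: open_borel.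
apply: (@le_trans _ _ (m V)); first by apply: ge_ereal_inf; exists (m V) => //; exists V.
rewrite -(setDUK AV) measureU//; last by rewrite setDE setICA setICr setI0.
  rewrite leeD2l//; apply: le_trans (epsilon_trick0 xpredT (ltW e0)).
  apply: (@le_trans _ _ (\sum_(0 <= i <oo) m ((P i `\` A) `&` b i))).
    apply: measure_sigma_subadditive.
    - move=> i; have [oO _ _] := HP i.
      by apply: measurableI => //; apply: measurableD => //; exact: open_borel.
    - exact: measurableD.
    - by move=> x [[i _ [Ox bx]] nAx]; exists i.
  by apply: lee_nneseries => // i _; have [_ _ ?] := HP i; exact: ltW.
exact: measurableD.
Qed.

End Regularity.


(** * Translations *)

Lemma pushforward_measure (R : realType) d d' (T1 : measurableType d)
    (T2 : measurableType d') (m : {measure set T1 -> \bar R}) (f : T1 -> T2) :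
  measurable_fun [set: T1] f ->
  exists m' : {measure set T2 -> \bar R}, forall A, m' A = m (f @^-1` A).
Proof.
by move=> mf; exists (measure_function_pushforward__canonical__measure_function_Measure m mf).
Qed.

Section LebesgueShift.
Local Open Scope ereal_scope.

Lemma lebesgue_measure_shift (R : realType) (s : R) (P : set R) : measurable P ->
  lebesgue_measure [set r : R | P (r + s)%R] = lebesgue_measure P.
Proof.
move=> mP; pose f (r : R) := (r + s)%R.
have mf : measurable_fun [set: measurableTypeR R] (f : measurableTypeR R -> measurableTypeR R).
  exact: measurable_realfun.measurable_funD.
have [m mE] := pushforward_measure lebesgue_measure mf.
rewrite -[LHS]mE; apply/esym/lebesgue_measure_unique => //.
move=> X -[[a b] _ <-] /=; rewrite mE.
have -> : f @^-1` `]a, b]%classic = `](a - s)%R, (b - s)%R]%classic.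
  by apply/seteqP; split=> r; rewrite /f/= !in_itv/= ltrBlDr lerBrDr.
apply: (etrans _ (esym (lebesgue_measure_itv `](a - s)%R, (b - s)%R]))).
rewrite lebesgue_measure_itv/= !lte_fin ltrD2r.
by case: ifPn => // _; rewrite -!EFinD opprD opprK addrACA addNr addr0.
Qed.

(** Rotation invariance on the circle [R / Z], read on the fundamental domain [[0, 1)]: once [s] is
    reduced to its fractional part [t], the domain becomes [[t, 1 + t)], whose piece [[1, 1 + t)] is
    moved back by 1. *)
Lemma lebesgue_measure_periodic (R : realType) (s : R) (P : set R) : measurable P ->
  (forall r, P (r + 1)%R <-> P r) ->
  lebesgue_measure (`[0%R, 1%R[ `&` [set r : R | P (r + s)%R]) =
  lebesgue_measure (`[0%R, 1%R[ `&` P).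
Proof.
move=> mP perP.
have perN (n : nat) r : P (r + n%:R)%R <-> P r.
  elim: n r => [|n IH] r; first by rewrite addr0.
  by rewrite -natr1 addrA perP.
have perZ (n : int) r : P (r + n%:~R)%R <-> P r.
  by case: n => n; [exact: perN|rewrite NegzE mulrNz -{2}[r](subrK (n.+1%:R)) perN].
pose t := (s - (Num.floor s)%:~R)%R.
have t0 : (0 <= t)%R by rewrite subr_ge0 floor_le.
have t1 : (t < 1)%R by have /andP[_] := floor_itv s; rewrite intrD addrC -ltrBlDr.
have mI (a b : R) : measurable (`[a, b[%classic : set R) by exact: measurable_itv.
have -> : [set r : R | P (r + s)%R] = [set r : R | P (r + t)%R].
  by apply/seteqP; split=> r /=; rewrite /t addrA -(perZ (Num.floor s) (_ - _)%R) subrK.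
have -> : `[0%R, 1%R[%classic `&` [set r : R | P (r + t)%R] =
    [set r : R | (`[t, (1 + t)%R[ `&` P) (r + t)%R].
  by apply/seteqP; split=> r /=; rewrite !in_itv/= lerDr ltrD2r.
rewrite lebesgue_measure_shift; last exact: measurableI.
have -> : `[t, (1 + t)%R[ `&` P = (`[t, 1%R[ `&` P) `|` (`[1%R, (1 + t)%R[ `&` P).
  rewrite -setIUl; congr (_ `&` _); apply/seteqP; split=> r /=; rewrite !in_itv/=.
    by move=> /andP[tr rt]; have [r1|r1] := ltP r 1%R; [left|right]; rewrite ?tr ?rt.
  move=> [/andP[-> r1]|/andP[r1 ->]] /=; first by rewrite (lt_le_trans r1)// lerDl.
  by rewrite (le_trans (ltW t1)).
have -> : `[0%R, 1%R[ `&` P = (`[t, 1%R[ `&` P) `|` (`[0%R, t[ `&` P).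
  rewrite -setIUl; congr (_ `&` _); apply/seteqP; split=> r /=; rewrite !in_itv/=.
    by move=> /andP[r0 r1]; have [rt|rt] := ltP r t; [right|left]; rewrite ?r0 ?r1.
  move=> [/andP[tr ->]|/andP[-> rt]] /=; first by rewrite (le_trans t0).
  by rewrite (lt_trans rt).
rewrite !measureU//; first last.
- by apply/seteqP; split=> r //= -[[+ _] [+ _]]; rewrite !in_itv/= => /andP[_ r1] /andP[tr _];
  rewrite ltNge tr in r1.
- exact: measurableI.
- exact: measurableI.
- by apply/seteqP; split=> r //= -[[+ _] [+ _]]; rewrite !in_itv/= => /andP[tr _] /andP[_ rt];
  rewrite ltNge tr in rt.
- exact: measurableI.
- exact: measurableI.
congr (_ + _); apply: (etrans (esym (@lebesgue_measure_shift _ 1%R _ _))); first exact: measurableI.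
congr lebesgue_measure; apply/seteqP; split=> r /=; rewrite !in_itv/= perP addrC.
  by move=> [/andP[r0 r1] ?]; split=> //; rewrite -(lerD2l 1%R) -(ltrD2l 1%R r) addr0 r0.
by move=> [/andP[r0 r1] ?]; split=> //; rewrite lerDl ltrD2l r0.
Qed.

End LebesgueShift.

Section TopologicalGroup.
Context {G : topologicalZmodType}.
Implicit Types (x t : G) (A : set G).

Lemma shift_continuous t : continuous (fun x : G => x + t).
Proof.
move=> x; apply: (@continuous_comp _ _ _ (fun x => (x, t)) (fun z : G * G => z.1 + z.2)).
  by apply: cvg_pair => /=; [exact: cvg_id|exact: cvg_cst].
exact: add_continuous.
Qed.

Lemma nbhs_shift x t A : nbhs (x + t) A -> nbhs x [set y | A (y + t)].
Proof. exact: shift_continuous. Qed.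

Lemma nbhs0_shift x A : nbhs x A <-> nbhs (0 : G) [set v | A (x + v)].
Proof.
have -> : [set v | A (x + v)] = [set v | A (v + x)].
  by apply/seteqP; split=> v /=; rewrite addrC.
split=> [nA|]; first by apply: nbhs_shift; rewrite add0r.
rewrite -(subrr x) => /nbhs_shift; congr nbhs.
by apply/seteqP; split=> v /=; rewrite subrK.
Qed.

Lemma open_shift t A : open A -> open [set x | A (x + t)].
Proof. by move=> oA; apply: open_comp => // x _; exact: shift_continuous. Qed.

Lemma nbhs0_opp A : nbhs (0 : G) A -> nbhs (0 : G) [set v | A (- v)].
Proof. by move=> nA; have := @opp_continuous G 0; rewrite /continuous_at oppr0; apply. Qed.

Lemma nbhs0_add A : nbhs (0 : G) A ->
  exists2 B, nbhs (0 : G) B & forall a b, B a -> B b -> A (a + b).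
Proof.
move=> nA; have := @add_continuous G (0, 0); rewrite /continuous_at /= addr0.
move=> /(_ _ nA) [[P Q] /= [nP nQ] PQ]; exists (P `&` Q); first exact: filterI.
by move=> a b [Pa _] [_ Qb]; apply: (PQ (a, b)).
Qed.

Lemma image_shift t A : [set t + a | a in A] = [set x | A (x - t)].
Proof.
apply/seteqP; split=> [_ [a Aa <-]|x Ax] /=; first by rewrite addrAC subrr add0r.
by exists (x - t) => //; rewrite addrC subrK.
Qed.

Lemma shift_measurable t :
  measurable_fun [set: borel_space G] (fun x : borel_space G => (x : G) + t : borel_space G).
Proof.
move=> mT B mB; apply: (@measurability _ _ (borel_space G) (borel_space G) setT _ (@open G)
  erefl _ mT B mB) => _ [A oA <-].
rewrite setTI; apply: open_borel.
exact: open_shift.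
Qed.

Lemma borelD A B : Borel A -> Borel B -> Borel (A `\` B).
Proof. exact: (@measurableD _ (borel_space G)). Qed.

Lemma borel_shift t A : Borel A -> Borel [set x | A (x + t)].
Proof. by move=> bA; have := @shift_measurable t measurableT A bA; rewrite setTI. Qed.

End TopologicalGroup.

(** The members with compact closure of a countable basis still form a basis, by regularity of
    locally compact Hausdorff spaces. *)
Lemma lch_countable_basis (E : topologicalType) : hausdorff_space E ->
    locally_compact [set: E] -> @second_countable E ->
  exists b c : nat -> set E, [/\ forall i, open (b i), forall i, compact (c i),
    forall i, b i `<=` c i &
    forall (A : set E) x, open A -> A x -> exists2 i, b i x & c i `<=` A].
Proof.
move=> hE lE [F cF [oF bF]].
have /countable_injP[f finj] := cF.
(* The union has at most one member, as [f] is injective on [F]; an index that codes no such member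
   gives the empty set. *)
pose b i := \bigcup_(B in [set B | [/\ F B, compact (closure B) & f B = i]]) B.
have cb i : compact (closure (b i)).
  have [[B [FB cB fB]]|nB] := pselect (exists B, [/\ F B, compact (closure B) & f B = i]).
    suff -> : b i = B by [].
    apply/seteqP; split=> [x [C [FC cC fC] Cx]|x Bx]; last by exists B.
    by rewrite -(finj C B) ?inE// fC.
  suff -> : b i = set0 by rewrite closure0; exact: compact0.
  by rewrite -subset0 => x [C FC _]; apply: nB; exists C.
exists b, (fun i => closure (b i)); split=> //.
- by move=> i; apply: bigcup_open => B [FB _ _]; exact: oF.
- by move=> i; exact: subset_closure.
- move=> A x oA Ax; have [K nK [cK clK]] := lE x I.
  have nK' : nbhs x K by move: nK; rewrite withinET.
  have [C nC CA] := compact_regular hE cK nK' (open_nbhs_nbhs (conj oA Ax)).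
  have [B [FB Bx] BCK] := bF x _ (filterI nC nK').
  have BC : B `<=` C by move=> y /BCK [].
  have BK : B `<=` K by move=> y /BCK [].
  have cB : compact (closure B).
    apply: subclosed_compact cK _; first exact: closed_closure.
    by rewrite closureE; apply: smallest_sub.
  have bE : b (f B) = B.
    apply/seteqP; split=> [y [C' [FC cC fC] Cy]|y By]; last by exists B.
    by rewrite -(finj C' B) ?inE.
  by exists (f B); rewrite bE//; apply: subset_trans CA; exact: closure_subset.
Qed.

(** * Discrete subgroups and generic linear forms *)

Lemma countable_enum (T : Type) (A : set T) (x0 : T) : countable A -> A x0 ->
  exists f : nat -> T, forall x, A x -> exists k, f k = x.
Proof.
move=> /countable_injP[f finj] Ax0.
have /choice[g gP] : forall k, exists y, forall x, A x -> f x = k -> y = x.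
  move=> k; have [[x [Ax fx]]|nx] := pselect (exists x, A x /\ f x = k).
    by exists x => y Ay fy; apply: finj; rewrite ?inE// fy.
  by exists x0 => x Ax fx; case: nx; exists x.
by exists g => x Ax; exists (f x); exact: gP.
Qed.

(** Such a chain is a base at 0 of a first countable group topology, possibly coarser than that of
    [H]; it arises by repeated halving and symmetrizing inside the [N n]. *)
Lemma nbhs_chain (H : topologicalZmodType) (N : nat -> set H) :
    (forall n, nbhs (0 : H) (N n)) ->
  exists V : nat -> set H, [/\ forall n, nbhs (0 : H) (V n),
    forall n, V n `<=` N n, forall n a, V n a -> V n (- a) &
    forall n a b, V n.+1 a -> V n.+1 b -> V n (a + b)].
Proof.
move=> Nn.
(* The premise stands under the existential so that choice yields a halving function defined on all
   sets. *)
have half (A : set H) : exists B : set H, nbhs (0 : H) A ->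
    [/\ nbhs (0 : H) B, B `<=` A, forall a, B a -> B (- a) &
        forall a b, B a -> B b -> A (a + b)].
  have [nA|] := pselect (nbhs (0 : H) A); last by exists set0.
  have [B nB BA] := nbhs0_add nA.
  exists (B `&` [set v | B (- v)]) => _; split.
  - by apply: filterI => //; exact: nbhs0_opp.
  - by move=> v [Bv _]; rewrite -[v]addr0; apply: BA => //; exact: nbhs_singleton.
  - by move=> v [Bv BNv]; split=> //=; rewrite opprK.
  - by move=> a b [Ba _] [Bb _]; exact: BA.
have /choice[h hP] := half.
pose V := fix V n := if n is n'.+1 then h (V n' `&` N n) else h (N 0%N).
have nV n : nbhs (0 : H) (V n).
  elim: n => [|n IH] /=; first by have [] := hP _ (Nn 0%N).
  by have [] := hP _ (filterI IH (Nn n.+1)).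
exists V; split=> //.
- case=> [|n] /=; first by have [] := hP _ (Nn 0%N).
  by have [_ sub _ _] := hP _ (filterI (nV n) (Nn n.+1)) => v /sub[].
- case=> [|n] /=; first by have [] := hP _ (Nn 0%N).
  by have [] := hP _ (filterI (nV n) (Nn n.+1)).
- move=> n a b; have [_ _ _ add] := hP _ (filterI (nV n) (Nn n.+1)).
  by move=> Va Vb; have [] := add _ _ Va Vb.
Qed.

(** The tube lemma: by compactness of [K], one neighbourhood of 0 serves all its points. *)
Lemma compact_tube (H : topologicalZmodType) (K A : set H) : compact K -> open A ->
  K `<=` A -> nbhs (0 : H) [set v | forall k, K k -> A (k + v)].
Proof.
move=> /compact_near_coveringP cK oA KA.
apply: (cK H (nbhs (0 : H)) (fun v k => A (k + v))) => k Kk.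
have := @add_continuous H (k, 0); rewrite /continuous_at /= addr0.
move=> /(_ _ (open_nbhs_nbhs (conj oA (KA _ Kk)))) [[P Q] /= [nP nQ] PQ].
exists (P, Q) => //= -[k' v] /= [Pk Qv]; exact: (PQ (k', v)).
Qed.

(** The subgroup generated by [Q], as the union of iterated difference sets; it is open because it
    contains the neighbourhood [Q] of 0. *)
Lemma sigma_compact_subgroup (H : topologicalZmodType) (Q : set H) :
    compact Q -> nbhs (0 : H) Q ->
  exists C : nat -> set H, [/\ forall n, compact (C n), Q `<=` C 0%N,
    open (\bigcup_n C n) &
    forall a b, (\bigcup_n C n) a -> (\bigcup_n C n) b -> (\bigcup_n C n) (a - b)].
Proof.
move=> cQ nQ.
pose C := fix C n := if n is n'.+1 then [set z.1 - z.2 | z in C n' `*` C n'] else Q.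
have cC n : compact (C n).
  elim: n => //= n IH; apply: continuous_compact; last exact: compact_setX.
  by apply: continuous_subspaceT => z; exact: sub_continuous.
have C0 n : C n 0.
  elim: n => [|n IH] /=; first exact: nbhs_singleton.
  by exists (0, 0) => //=; rewrite subr0.
have CS n : C n `<=` C n.+1.
  by move=> a Ca; exists (a, 0) => /=; [split=> //; exact: C0|rewrite subr0].
have Cle n m : (n <= m)%N -> C n `<=` C m.
  by move=> /subnK <-; elim: (m - n)%N => // k IH v /IH /CS.
have CB a b : (\bigcup_n C n) a -> (\bigcup_n C n) b -> (\bigcup_n C n) (a - b).
  move=> [n _ Ca] [m _ Cb]; exists (maxn n m).+1 => //=; exists (a, b) => //=; split.
    by apply: Cle Ca; exact: leq_maxl.
  by apply: Cle Cb; exact: leq_maxr.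
exists C; split=> //.
rewrite openE => a Ca; apply/nbhs0_shift; apply: filterS nQ => v Qv /=.
rewrite -[v]opprK; apply: (CB) => //; rewrite -sub0r; by apply: CB; exists 0%N.
Qed.

(** In a separable, first countable group, the translates of the interiors of the [b n] by the
    points of [D] form a countable basis. *)
Lemma dense_second_countable (E : topologicalZmodType) (b : nat -> set E) (D : set E) :
    countable D -> dense D -> (forall n, nbhs (0 : E) (b n)) ->
    (forall A, nbhs (0 : E) A -> exists n, b n `<=` A) ->
  @second_countable E.
Proof.
move=> cD dD bn bA.
pose F := \bigcup_(n in [set: nat]) [set [set y | (b n)° (y - t)] | t in D].
exists F.
  apply: bigcup_countable => [|n _]; first exact: countableP.
  by apply: card_le_trans cD; exact: card_image_le.
split=> [A [n _ [t Dt <-]]|y A]; first by apply: open_shift; exact: open_interior.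
move=> /nbhs0_shift /nbhs0_add[B nB BA]; have [n bB] := bA _ nB.
have b0 : (b n)° 0 by exact: bn.
(* The point [t] is close to [y] in two ways: [y] lies in the basic set at [t], and [t - y] is so
   small that this set stays inside [A]. *)
have [||t [[bt Bt] Dt]] := dD [set t | (b n)° (y - t) /\ B° (t - y)].
- by exists y => /=; rewrite subrr; split.
- apply: openI; last by apply: open_shift; exact: open_interior.
  rewrite (_ : (fun t => _) = (fun t => - t) @^-1` [set s | (b n)° (s + y)]); last first.
    by apply/seteqP; split=> t /=; rewrite addrC.
  apply: open_comp => [t _|]; first exact: opp_continuous.
  by apply: open_shift; exact: open_interior.
- exists [set z | (b n)° (z - t)]; first by split=> //; exists n => //; exists t.
  move=> z /interior_subset /bB Bzt; have := BA _ _ (interior_subset Bt) Bzt => /=.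
  have -> // : y + (t - y + (z - t)) = z.
  by rewrite addrA [y + (t - y)]addrC subrK addrC subrK.
Qed.

(** Finitely many boxes, each with all its differences in [N], cover [K], and a box contains at most
    one point of [L]; the intersection is thus even finite. *)
Lemma discrete_subgroup_countable (G H : topologicalZmodType) (L K N : set (G * H)) :
    (forall a b, L a -> L b -> L (a.1 - b.1, a.2 - b.2)) ->
    nbhs ((0, 0) : G * H) N -> N `&` L `<=` [set (0, 0)] -> compact K ->
  countable (K `&` L).
Proof.
move=> LB [[P Q] /= [nP nQ] PQN] NL cK.
have [V [nV VP VN VD]] := nbhs_chain (fun _ => nP).
have [V' [nV' VQ VN' VD']] := nbhs_chain (fun _ => nQ).
pose A (t : G * H) := [set z : G * H | (V 1%N)° (z.1 - t.1) /\ (V' 1%N)° (z.2 - t.2)].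
have [|z Kz|s sK] := @compact_finite_cover (G * H)%type (G * H)%type K A cK.
- move=> t; apply: openI.
    apply: (@open_comp _ _ (fst : G * H -> G) [set y | (V 1%N)° (y - t.1)]) => [z _|].
      exact: cvg_fst.
    by apply: open_shift; exact: open_interior.
  apply: (@open_comp _ _ (snd : G * H -> H) [set y | (V' 1%N)° (y - t.2)]) => [z _|].
    exact: cvg_snd.
  by apply: open_shift; exact: open_interior.
- by exists z => //; split; rewrite subrr; [exact: nV|exact: nV'].
apply/countable_injP.
have /choice[f fP] : forall z, exists i, K z -> A (nth (0, 0) s i) z.
  move=> z; have [/sK[t ts At]|nK] := pselect (K z); last by exists 0%N.
  by exists (index t s) => _; rewrite nth_index.
exists f => z z'; rewrite !inE => -[Kz Lz] [Kz' Lz'] ff.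
have [Az1 Az2] := fP _ Kz; rewrite ff in Az1 Az2.
have [Az'1 Az'2] := fP _ Kz'.
have /NL : (N `&` L) (z.1 - z'.1, z.2 - z'.2).
  split; last exact: LB.
  apply: PQN; split => /=.
    apply: (VP 0%N); set t := nth _ _ _ in Az'1 Az1.
    have -> : z.1 - z'.1 = (z.1 - t.1) + - (z'.1 - t.1) by rewrite opprB addrA subrK.
    by apply: VD; [exact: interior_subset Az1|apply: VN; exact: interior_subset Az'1].
  apply: (VQ 0%N); set t := nth _ _ _ in Az'2 Az2.
  have -> : z.2 - z'.2 = (z.2 - t.2) + - (z'.2 - t.2) by rewrite opprB addrA subrK.
  by apply: VD'; [exact: interior_subset Az2|apply: VN'; exact: interior_subset Az'2].
case=> /eqP; rewrite subr_eq0 => /eqP e1 /eqP; rewrite subr_eq0 => /eqP e2.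
by rewrite [z]surjective_pairing [z']surjective_pairing e1 e2.
Qed.

Lemma rV_sigma_compact (R : realType) d :
  exists B : nat -> set 'rV[R]_d, (forall n, compact (B n)) /\ \bigcup_n B n = setT.
Proof.
exists (fun n => [set v | forall i, `[(- n%:R)%R, n%:R]%classic (v ord0 i)]); split.
  by move=> n; apply: (@rV_compact R d (fun=> `[- n%:R, n%:R]%classic)) => i; exact: segment_compact.
apply/seteqP; split=> // v _.
pose F (i : 'I_d) := Num.bound `|v ord0 i|; exists (\max_(i < d) F i) => // i /=.
rewrite in_itv/= -ler_norml; apply: ltW; apply: lt_le_trans (archi_boundP _) _ => //.
by rewrite ler_nat; exact: (@leq_bigmax _ F i).
Qed.

(** As [H] need not be sigma-compact, [L] may be uncountable; only its part over a sigma-compact set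
    is exhausted by countably many compact products. *)
Lemma discrete_subgroup_countable_cut (R : realType) d (H : topologicalZmodType)
    (L N : set ('rV[R]_d * H)) (C : nat -> set H) :
    (forall a b, L a -> L b -> L (a.1 - b.1, a.2 - b.2)) ->
    nbhs ((0, 0) : 'rV[R]_d * H) N -> N `&` L `<=` [set (0, 0)] ->
    (forall n, compact (C n)) ->
  countable [set l | L l /\ (\bigcup_n C n) l.2].
Proof.
move=> LB nN NL cC; have [B [cB BT]] := rV_sigma_compact R d.
have -> : [set l | L l /\ (\bigcup_n C n) l.2] =
    \bigcup_n \bigcup_m ((B n `*` C m) `&` L).
  apply/seteqP; split=> [l [Ll [m _ Cl]]|l [n _ [m _ [[_ Cl] Ll]]]]; last by split=> //; exists m.
  have : (\bigcup_n B n) l.1 by rewrite BT.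
  by move=> [n _ Bl]; exists n => //; exists m.
apply: bigcup_countable => [|n _]; first exact: countableP.
apply: bigcup_countable => [|m _]; first exact: countableP.
by apply: discrete_subgroup_countable nN NL _ => //; exact: compact_setX.
Qed.

(** The exponents start at 1, which leaves the constant coefficient, in the variable [a], free for
    the integer to be avoided. *)
Definition powers_form (R : realType) d (a : R) (v : 'rV[R]_d) : R :=
  \sum_(i < d) a ^+ i.+1 * v ord0 i.

Lemma powers_formD (R : realType) d (a : R) (u v : 'rV[R]_d) :
  powers_form a (u + v) = powers_form a u + powers_form a v.
Proof. by rewrite /powers_form -big_split; apply: eq_bigr => i _; rewrite mxE mulrDr. Qed.

Lemma poly_roots_countable (R : realType) (p : {poly R}) : p != 0 ->
  countable [set a | root p a].
Proof.
move=> p0; apply: finite_set_countable; apply: contrapT => /(infinite_set_fset (size p))[B Bp].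
rewrite leqNgt => /negP; apply; apply: max_poly_roots p0 _ _; last exact: finmap.fset_uniq.
by apply/allP => a /Bp.
Qed.

(** For [v != 0] equality with [n] is a nontrivial polynomial equation in [a]. The countably many
    pairs of [v] and [n] thus exclude only a countable, hence Lebesgue null, set of values. *)
Lemma generic_powers_form (R : realType) d (P : set 'rV[R]_d) : countable P ->
  exists a : R, forall v, P v -> v != 0 -> forall n : int, powers_form a v != n%:~R.
Proof.
move=> cP.
pose p (v : 'rV[R]_d) (n : int) : {poly R} := \sum_(i < d) (v ord0 i) *: 'X^(i.+1) - (n%:~R)%:P.
have pE v n a : (p v n).[a] = powers_form a v - n%:~R.
  rewrite /p !hornerE horner_sum; congr (_ - _); apply: eq_bigr => i _.
  by rewrite !hornerE mulrC.
have p0 v n : v != 0 -> p v n != 0.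
  apply: contra => /eqP pz; apply/eqP/rowP => i; rewrite mxE.
  have := congr1 (fun q : {poly R} => q`_i.+1) pz.
  rewrite /p coefB coefC /= subr0 coef0 coef_sum (bigD1 i)//= coefZ coefXn eqxx mulr1.
  rewrite big1 ?addr0// => k ki; rewrite coefZ coefXn eqSS.
  by rewrite eq_sym val_eqE (negPf ki) mulr0.
pose bad := \bigcup_(v in P `&` [set v | v != 0]) \bigcup_(n in [set: int]) [set a | root (p v n) a].
have cb : countable bad.
  apply: bigcup_countable => [|v [_ v0]].
    by apply: sub_countable cP; apply: subset_card_le => v [].
  apply: bigcup_countable => [|n _]; first exact: countableP.
  by apply: poly_roots_countable; exact: p0.
have [a na] : exists a, ~ bad a.
  apply/existsNP => ball; have : bad = setT by apply/seteqP; split.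
  move=> bT; have := countable_lebesgue_measure0 cb; rewrite bT.
  have := lebesgue_measure_itv (`]-oo, +oo[ : interval R); rewrite /= set_itvNyy => ->.
  by rewrite /=.
exists a => v Pv v0 n; apply/negP => /eqP e; apply: na; exists v => //; exists n => //=.
by rewrite rootE pE e subrr.
Qed.

(** Density of an irrational rotation: there is a nonzero [b = a *~ k - m%:~R] with [|b| < eps], and
    some integer multiple of [b] is within [|b|] of [r]. *)
Lemma multiples_dense_mod1 (R : realType) (a : R) :
    (forall k m : int, k != 0 -> a *~ k != m%:~R) ->
  forall r eps : R, 0 < eps -> exists k m : int, `|a *~ k + m%:~R - r| < eps.
Proof.
move=> irr r eps eps0.
pose frac (y : R) := y - (Num.floor y)%:~R.
have frac_ge0 y : 0 <= frac y by rewrite subr_ge0 floor_le.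
have frac_lt1 y : frac y < 1.
  by have /andP[_] := floor_itv y; rewrite intrD addrC -ltrBlDr.
have [k [m [b0 beps]]] : exists k m : int, let b := a *~ k - m%:~R in b != 0 /\ `|b| < eps.
  (* Pigeonhole on the fractional parts of the first N + 1 multiples of a. *)
  pose M := Num.bound eps^-1; pose N := M.+1.
  have N0 : 0 < N%:R :> R by rewrite ltr0n.
  have Neps : N%:R^-1 < eps.
    rewrite -[eps]invrK ltf_pV2 ?posrE ?invr_gt0//.
    apply: lt_trans (archi_boundP _) _; first by rewrite invr_ge0 ltW.
    by rewrite ltr_nat ltnSn.
  pose t (k : nat) := N%:R * frac (a *+ k).
  have t0 k : 0 <= t k by rewrite mulr_ge0// ltW.
  have tN k : (Num.truncn (t k) < N)%N.
    have /andP[tl _] := truncn_itv (t0 k).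
    rewrite -(ltr_nat R); apply: le_lt_trans tl _.
    by rewrite /t gtr_pMr.
  pose f (k : 'I_N.+1) : 'I_N := Ordinal (tN k).
  have /injectivePn[k1 [k2 k12 fk]] : ~~ injectiveb f.
    apply/negP => /injectiveP /leq_card; by rewrite !card_ord ltnn.
  exists (k1%:Z - k2%:Z), (Num.floor (a *+ k1) - Num.floor (a *+ k2)) => /=; split.
    rewrite subr_eq0; apply: irr; rewrite subr_eq0.
    by apply: contra k12 => /eqP[e]; apply/eqP/val_inj.
  have -> : a *~ (k1%:Z - k2%:Z) - (Num.floor (a *+ k1) - Num.floor (a *+ k2))%:~R =
      frac (a *+ k1) - frac (a *+ k2).
    by rewrite mulrzBr intrB /frac !opprD !opprK -!pmulrn addrACA.
  apply: lt_trans Neps; rewrite -(ltr_pM2l N0) divff ?gt_eqF//.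
  rewrite -[X in X * _](gtr0_norm N0) -normrM mulrBr -/(t k1) -/(t k2).
  have /andP[l1 u1] := truncn_itv (t0 k1); have /andP[l2 u2] := truncn_itv (t0 k2).
  have e : Num.truncn (t k1) = Num.truncn (t k2) by have := congr1 val fk.
  rewrite e -natr1 in l1 u1; rewrite -natr1 in u2.
  by rewrite ltr_norml; apply/andP; split; lra.
set b := a *~ k - m%:~R in b0 beps.
(* The number [b] may be negative; for either sign [r - b *~ n] is [b] times the fractional part of
   [r / b]. *)
pose n := Num.floor (r / b).
exists (k * n), (- (m * n)).
have -> : a *~ (k * n) + (- (m * n))%:~R - r = - (b * frac (r / b)).
  rewrite /frac mulrBr mulrCA divff// mulr1 opprB -/n /b.
  by rewrite mulrzA intrN intrM -[(a *~ k) *~ n]mulrzr mulrBl.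
rewrite normrN normrM (ger0_norm (frac_ge0 _)).
by apply: le_lt_trans beps; rewrite ler_piMr// ltW.
Qed.


(** * Extension of a Haar measure *)

Section HaarExtension.
Local Open Scope ereal_scope.
Context {R : realType} {H E : topologicalZmodType}.
Variables (H0 : set H) (V : nat -> set H) (j : H -> R -> E).
Hypothesis H0_open : open H0.
Hypothesis H00 : H0 0%R.
Hypothesis H0B : forall a b, H0 a -> H0 b -> H0 (a - b)%R.
Hypothesis V_nbhs : forall n, nbhs (0%R : H) (V n).
Hypothesis V_H0 : forall n, V n `<=` H0.
Hypothesis VN : forall n a, V n a -> V n (- a)%R.
Hypothesis VD : forall n a b, V n.+1 a -> V n.+1 b -> V n (a + b)%R.
Hypothesis jD : forall h h' r r', H0 h -> H0 h' -> j (h + h')%R (r + r')%R = (j h r + j h' r')%R.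
Hypothesis j1 : j 0%R 1%R = 0%R.
Hypothesis j_nbhs : forall A : set E, nbhs (0%R : E) A <->
  exists n, forall v r, V n v -> (`|r| < 2^-1 ^+ n)%R -> A (j v r).
Hypothesis j_ker : forall h h' r r' n, H0 h -> H0 h' -> j h r = j h' r' -> V n (h - h')%R.
Hypothesis hE : hausdorff_space E.
Hypothesis lE : locally_compact [set: E].
Hypothesis sE : @second_countable E.
Variables (D : nat -> H) (e : nat -> E).
Hypothesis D_dense : forall h A, H0 h -> nbhs h A -> exists k, A (D k).
Hypothesis e_cover : forall x, exists k h r, H0 h /\ x = (e k + j h r)%R.

Let H0D a b : H0 a -> H0 b -> H0 (a + b)%R.
Proof. by move=> Ha Hb; rewrite -[b]opprK; apply: H0B => //; rewrite -sub0r; exact: H0B. Qed.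

Let H0N a : H0 a -> H0 (- a)%R.
Proof. by move=> Ha; rewrite -sub0r; exact: H0B. Qed.

Let jj (z : borel_space H * measurableTypeR R) : borel_space E :=
  if `[< H0 z.1 >] then j z.1 z.2 else 0%R.

(** The product sigma-algebra need not contain all open subsets of the product. The preimage of an
    open set is therefore written as a countable union of boxes centred at points [D k] and
    rationals; these suffice because the neighbourhoods in [E] involve only the [V n] and real
    intervals. *)
Let jj_measurable : measurable_fun setT jj.
Proof.
move=> mT B mB.
apply: (@measurability _ _ _ (borel_space E) setT _ (@open E) erefl _ mT B mB).
move=> _ [A oA <-]; rewrite setTI.
have mH0 : measurable (H0 : set (borel_space H)) by exact: open_borel.
pose box (i : nat * rat * nat) : set (borel_space H * measurableTypeR R) :=
  let: (k, q, n) := i in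
  [set h | (V n)° (h - D k)%R] `*` `](ratr q - 2^-1 ^+ n)%R, (ratr q + 2^-1 ^+ n)%R[%classic.
pose good (i : nat * rat * nat) := box i `<=` [set z | H0 z.1 /\ A (j z.1 z.2)].
(* Off [H0] the map is constantly 0, which contributes the second set, empty unless [A] contains
   0. *)
have -> : jj @^-1` A = (\bigcup_(i in good) box i) `|`
    ((~` H0 `&` [set _ | A 0%R]) `*` setT).
  apply/seteqP; split=> [[h r]|[h r]] /=; rewrite /jj /=; case: asboolP => //= Hh.
  - move=> Ajr; left.
    have /j_nbhs[n Hn] : nbhs (0%R : E) [set x | A (j h r + x)%R].
      by apply/(nbhs0_shift (j h r) A); exact: open_nbhs_nbhs.
    pose Y := [set y | (V n.+1)° (h - y)%R /\ H0 y].
    have [k Vk] : exists k, Y (D k).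
      apply: (D_dense Hh); apply/(nbhs0_shift h).
      rewrite (_ : mkset _ = [set v | (V n.+1)° (- v)%R] `&` [set v | H0 (h + v)%R]).
        apply: filterI.
          by apply: nbhs0_opp; apply: open_nbhs_nbhs; split;
            [exact: open_interior|exact: V_nbhs].
        by apply/(nbhs0_shift h); exact: open_nbhs_nbhs.
      by apply/seteqP; split=> v; rewrite /Y /= opprD addrA subrr add0r.
    have e0 : (0 < 2^-1 ^+ n.+1 :> R)%R by rewrite exprn_gt0// invr_gt0.
    have [q rq] : exists q : rat, (`|r - ratr q| < 2^-1 ^+ n.+1)%R.
      have [|q] := @rat_in_itvoo R (r - 2^-1 ^+ n.+1)%R (r + 2^-1 ^+ n.+1)%R; first by lra.
      by rewrite in_itv/= -ltr_distl distrC; exists q.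
    exists (k, q, n.+1); last by split=> /=; [exact: Vk.1|rewrite in_itv/= -ltr_distl].
    move=> [h' r'] /= [/interior_subset Vh']; rewrite in_itv/= -ltr_distl => qr'.
    have Hh' : H0 h' by rewrite -(subrK (D k) h'); apply: H0D; [exact: V_H0 Vh'|exact: Vk.2].
    split=> //.
    have -> : j h' r' = (j h r + j (h' - h) (r' - r))%R.
      by rewrite -jD ?(addrC h) ?(addrC r) ?subrK//; exact: H0B.
    apply: Hn.
      rewrite -(subrK (D k) h') -addrA; apply: VD => //.
      by rewrite -opprB; apply: VN; exact: interior_subset Vk.1.
    rewrite -(subrK (ratr q) r') -addrA (le_lt_trans (ler_normD _ _))//.
    rewrite [ltRHS](_ : _ = 2^-1 ^+ n.+1 + 2^-1 ^+ n.+1)%R; last first.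
      by rewrite exprS; field.
    by apply: ltrD; [exact: qr'|rewrite distrC; exact: rq].
  - by move=> A0; right.
  - by move=> [[i ig /ig [_ //]]|[[]]].
  - by move=> [[i ig /ig [//]]|[[_ //]]].
apply: measurableU; last first.
  apply: measurableX => //; apply: measurableI; first exact: measurableC.
  by have [A0|A0] := pselect (A 0%R); [rewrite (_ : mkset _ = setT)|rewrite (_ : mkset _ = set0)] => //;
    apply/seteqP; split.
rewrite bigcup_mkcond; apply: countable_bigcupT_measurable => [|[[k q] n]].
  exact: countableP.
case: ifPn => // _; apply: measurableX.
  apply: open_borel; apply: open_shift; exact: open_interior.
exact: measurable_itv.
Qed.

Variable mu : {measure set (borel_space H) -> \bar R}.
Hypothesis mu_Haar : Haar_measure mu.

Let mu_shift t (A : set H) : Borel A -> mu [set h | A (h + t)%R] = mu A.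
Proof.
move=> bA; have [_ inv _ _ _] := mu_Haar.
by rewrite -(inv (- t)%R A bA) image_shift opprK.
Qed.

(** * The measure on the open subgroup *)

Let prodm : {measure set (borel_space H * measurableTypeR R) -> \bar R} :=
  (mu \x lebesgue_measure)%E.

Let prodmX (A : set (borel_space H)) (B : set (measurableTypeR R)) :
  measurable A -> measurable B -> prodm (A `*` B) = mu A * lebesgue_measure B.
Proof. exact: product_measure1E. Qed.

Let I01 : set (measurableTypeR R) := `[0%R, 1%R[%classic.

Let mD0 : measurable (H0 `*` I01 : set (borel_space H * measurableTypeR R)).
Proof. by apply: measurableX; [exact: open_borel|exact: measurable_itv]. Qed.

Let base_exists : exists m : {measure set (borel_space E) -> \bar R},
  forall A : set E, m A = prodm [set z | [/\ H0 z.1, I01 z.2 & A (j z.1 z.2)]].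
Proof.
have [m mE] := pushforward_measure (mrestr prodm mD0) jj_measurable.
exists m => A; rewrite mE /mrestr; congr (prodm _).
apply/seteqP; split=> [[h r] [+ []]|[h r] []] /=; rewrite /jj/=; case: asboolP => //.
Qed.

Let nu0 := projT1 (cid base_exists).
Let nu0E (A : set E) :
  nu0 A = prodm [set z | [/\ H0 z.1, I01 z.2 & A (j z.1 z.2)]].
Proof. exact: (projT2 (cid base_exists)). Qed.

Let j_measurable (A : set E) : Borel A ->
  measurable ([set z | H0 z.1 /\ A (j z.1 z.2)] : set (borel_space H * measurableTypeR R)).
Proof.
move=> bA; rewrite (_ : mkset _ = (H0 `*` setT) `&` (jj @^-1` A)).
  apply: measurableI; first by apply: measurableX => //; exact: open_borel.
  by have := jj_measurable measurableT bA; rewrite setTI.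
apply/seteqP; split=> [[h r] []|[h r] [[]]] /=; rewrite /jj /=; case: asboolP => //.
Qed.

Let nu0_measurable (A : set E) : Borel A ->
  measurable ([set z | [/\ H0 z.1, I01 z.2 & A (j z.1 z.2)]] : set (borel_space H * measurableTypeR R)).
Proof.
move=> bA; rewrite (_ : mkset _ = (H0 `*` I01) `&` [set z | H0 z.1 /\ A (j z.1 z.2)]).
  by apply: measurableI => //; exact: j_measurable.
by apply/seteqP; split=> [[h r] [? ? ?]|[h r] [[? ?] [? ?]]].
Qed.

Let nu0_bound (A : set E) (M : set H) : Borel A -> Borel M ->
  (forall h r, H0 h -> A (j h r) -> M h) -> nu0 A <= mu M.
Proof.
move=> bA bM AM; rewrite nu0E.
have mI : measurable I01 by exact: measurable_itv.
have -> : mu M = prodm (M `*` I01).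
  by rewrite prodmX//= lebesgue_measure_itv/= lte_fin ltr01 oppr0 addr0 mule1.
apply: le_measure; rewrite ?inE; [exact: nu0_measurable|exact: measurableX|].
by move=> [h r] [/= Hh Ir Aj]; split=> //=; exact: AM Aj.
Qed.

Let nu0T : nu0 setT = mu H0.
Proof.
rewrite nu0E (_ : mkset _ = H0 `*` I01); last first.
  by apply/seteqP; split=> [[h r] []|[h r] []].
have mI : measurable I01 by exact: measurable_itv.
rewrite prodmX//=; last exact: open_borel.
by rewrite lebesgue_measure_itv/= lte_fin ltr01 oppr0 addr0 mule1.
Qed.

Let j_periodic h r : H0 h -> j h (r + 1)%R = j h r.
Proof. by move=> Hh; rewrite -{1}[h]addr0 jD// j1 addr0. Qed.

(** In the iterated integral, adding [j h1 r1] rotates the sections by [r1], which preserves their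
    measure by periodicity, and translates the base by [h1], which preserves [mu]. *)
Let nu0_shift (A : set E) h1 r1 : Borel A -> H0 h1 ->
  nu0 [set x | A (x + j h1 r1)%R] = nu0 A.
Proof.
move=> bA Hh1; rewrite !nu0E /prodm /= /product_measure1.
pose f (h : borel_space H) : \bar R := lebesgue_measure (I01 `&` [set r | H0 h /\ A (j h r)]).
have secm h (B : set E) : Borel B -> measurable ([set r | H0 h /\ B (j h r)] : set R).
  move=> bB; have := @measurable_xsection _ _ (borel_space H) (measurableTypeR R) _ h (j_measurable bB).
  by rewrite xsectionE.
have fE h : f h = (lebesgue_measure \o xsection [set z | [/\ H0 z.1, I01 z.2 & A (j z.1 z.2)]]) h.
  rewrite /f /= xsectionE; congr lebesgue_measure.
  by apply/seteqP; split=> [r [? []]|r []].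
have mf : measurable_fun [set: borel_space H] f.
  rewrite (_ : f = lebesgue_measure \o xsection [set z | [/\ H0 z.1, I01 z.2 & A (j z.1 z.2)]]).
    by apply: measurable_fun_xsection; exact: nu0_measurable.
  by apply/funext => h; rewrite fE.
have mt := @shift_measurable H h1.
have [m mE] := pushforward_measure mu mt.
transitivity (\int[mu]_h (f \o (fun x : borel_space H => (x : H) + h1 : borel_space H)%R) h).
  apply: eq_integral => h _; rewrite /f /= xsectionE.
  have -> : [eta pair h] @^-1` [set z | [/\ H0 z.1, I01 z.2 & A (j z.1 z.2 + j h1 r1)%R]] =
      I01 `&` [set r | [set r' | H0 (h + h1)%R /\ A (j (h + h1)%R r')] (r + r1)%R].
    apply/seteqP; split=> [r [/= Hh Ir Aj]|r [/= Ir [Hh Aj]]] /=.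
      by split=> //; rewrite jD//; split=> //; exact: H0D.
    have Hh' : H0 h by rewrite -(addrK h1 h); exact: H0B.
    by rewrite -jD.
  apply: lebesgue_measure_periodic; first exact: secm.
  by move=> r /=; split=> -[Hh]; rewrite j_periodic.
rewrite -(@ge0_integral_pushforward _ _ _ _ _ _ mt mu setT f)//.
  rewrite (eq_measure_integral mu); first by apply: eq_integral => h _; rewrite fE.
  by move=> B mB _; rewrite /pushforward; exact: mu_shift.
Qed.

(** * Summation over the cosets of the open subgroup *)

Let E0 : set E := [set x | exists h r, H0 h /\ x = j h r].

Let j00 : j 0%R 0%R = 0%R.
Proof.
have := @jD 0%R 0%R 0%R 0%R H00 H00; rewrite !addr0 => /eqP.
by rewrite -subr_eq0 opprD addNKr oppr_eq0 => /eqP.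
Qed.

Let jN h r : H0 h -> j (- h)%R (- r)%R = (- j h r)%R.
Proof.
by move=> Hh; apply/eqP; rewrite -subr_eq0 opprK -jD ?addNr ?j00//; exact: H0N.
Qed.

Let E00 : E0 0%R. Proof. by exists 0%R, 0%R. Qed.

Let E0B x y : E0 x -> E0 y -> E0 (x - y)%R.
Proof.
move=> [h [r [Hh ->]]] [h' [r' [Hh' ->]]]; exists (h - h')%R, (r - r')%R.
by split; [exact: H0B|rewrite -jN// jD//; exact: H0N].
Qed.

Let E0N x : E0 x -> E0 (- x)%R.
Proof. by move=> Ex; rewrite -sub0r; exact: E0B. Qed.

Let E0D x y : E0 x -> E0 y -> E0 (x + y)%R.
Proof. by move=> Ex Ey; rewrite -[y]opprK; apply: E0B => //; exact: E0N. Qed.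

Let nu0_zero (A : set E) : Borel A -> (forall x, E0 x -> ~ A x) -> nu0 A = 0%R.
Proof.
move=> bA nA; apply/eqP; rewrite eq_le measure_ge0 andbT.
apply: le_trans (_ : mu set0 <= _); last by rewrite measure0.
apply: nu0_bound => //; first exact: (open_borel open0).
by move=> h r Hh /nA; apply; exists h, r.
Qed.


(* Each coset is represented by the first term of the covering sequence [e]
   that it contains. *)
Let coset_rep k := forall i, (i < k)%N -> ~ E0 (e k - e i)%R.

Let rep_cover x : exists2 k, coset_rep k & E0 (x - e k)%R.
Proof.
have ex : exists k, `[< E0 (x - e k)%R >].
  have [k [h [r [Hh ->]]]] := e_cover x; exists k; apply/asboolP.
  by exists h, r; rewrite addrAC subrr add0r.
case: (ex_minnP ex) => k /asboolP Ek kmin; exists k => // i ik Eki.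
have : (k <= i)%N.
  by apply: kmin; apply/asboolP; rewrite -(subrK (e k) x) -addrA; exact: E0D.
by rewrite leqNgt ik.
Qed.

Let rep_uniq i k : coset_rep i -> coset_rep k -> E0 (e i - e k)%R -> i = k.
Proof.
move=> ri rk Eik; apply/eqP; case: ltngtP => // ik.
  by have := rk _ ik; rewrite -opprB; case; exact: E0N.
by have := ri _ ik.
Qed.

Let nuk_exists k : exists m : {measure set (borel_space E) -> \bar R},
  forall A : set E, m A = if `[< coset_rep k >] then nu0 [set x | A (x + e k)%R] else 0%R.
Proof.
case: asboolP => rk; last by exists mzero.
by have [m mE] := pushforward_measure nu0 (@shift_measurable E (e k)); exists m => A; rewrite mE.
Qed.

Let nuk k := projT1 (cid (nuk_exists k)).
Let nukE k (A : set E) :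
  nuk k A = if `[< coset_rep k >] then nu0 [set x | A (x + e k)%R] else 0%R.
Proof. exact: (projT2 (cid (nuk_exists k))). Qed.

Let nu : {measure set (borel_space E) -> \bar R} := mseries nuk 0%N.

Let nuE (A : set E) : nu A = \esum_(k in coset_rep) nu0 [set x | A (x + e k)%R].
Proof.
rewrite /nu /= /mseries nneseries_esumT//.
rewrite [RHS]esum_mkcond; apply: eq_esum => k _; rewrite nukE.
by congr (if _ then _ else _); apply/asboolP/idP; rewrite inE.
Qed.

(** Translation by [t] permutes the cosets, and [s k] indexes the one containing [e k + t]. After
    reindexing, corresponding terms differ by a translation by an element of [E0], under which [nu0]
    is invariant. *)
Let nu_shift t (A : set E) : Borel A -> nu [set x | A (x + t)%R] = nu A.
Proof.
move=> bA; rewrite !nuE.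
have /choice[s sP] : forall k, exists i, coset_rep i /\ E0 (e k + t - e i)%R.
  by move=> k; have [i ri Ei] := rep_cover (e k + t)%R; exists i.
rewrite [RHS](@reindex_esum _ _ _ coset_rep coset_rep s); last first.
  split.
  - by move=> k _; exact: (sP k).1.
  - move=> i k; rewrite !inE => ri rk sik; apply: rep_uniq => //.
    have -> : (e i - e k = (e i + t - e (s i)) - (e k + t - e (s k)))%R.
      by rewrite sik; rewrite !opprD !opprK; rewrite addrACA -addrA addNr addr0 addrACA subrr addr0.
    by apply: E0B; [exact: (sP i).2|exact: (sP k).2].
  - move=> k rk; have [i ri Ei] := rep_cover (e k - t)%R; exists i => //.
    apply: rep_uniq => //; first exact: (sP i).1.
    have -> : (e (s i) - e k = - (e i + t - e (s i)) - (e k - t - e i))%R.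
      have -> : (e k - t - e i = e k - (e i + t))%R by rewrite opprD (addrC (- e i)%R) addrA.
      by rewrite !opprB addrA subrK.
    by apply: E0B => //; apply: E0N; exact: (sP i).2.
apply: eq_esum => k rk.
have [h [r [Hh gE]]] := (sP k).2.
apply: (etrans _ (nu0_shift r (borel_shift (e (s k)) bA) Hh)); rewrite -gE.
by congr (nu0 _); apply/seteqP; split=> x /=; rewrite -[(_ + e (s k))%R]addrA subrK addrA.
Qed.

Let nu_invariant t (A : set E) : Borel A -> nu [set (t + a)%R | a in A] = nu A.
Proof. by move=> bA; rewrite image_shift nu_shift. Qed.

(** * Finiteness on compact sets and nontriviality *)

Variable C : set H.
Hypothesis C_compact : compact C.
Hypothesis VC : V 0%N `<=` C.
Hypothesis hH : hausdorff_space H.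

(** The set [N0] lies in [E0], so a single coset contributes; by [j_ker] its preimage lies over
    [V 1 + V 1], hence over the compact set [C]. *)
Let nu_small : exists2 N0 : set E, open N0 /\ N0 0%R & nu N0 < +oo.
Proof.
pose N0 : set E := [set x | exists v r, V 1%N v /\ x = j v r]°.
have N0n : N0 0%R.
  by apply/j_nbhs; exists 1%N => v r Vv _; exists v, r.
have oN : open N0 by exact: open_interior.
have bN : Borel N0 by exact: open_borel.
have NE : N0 `<=` E0.
  by move=> x /interior_subset[v [r [Vv ->]]]; exists v, r; split=> //; exact: V_H0 Vv.
exists N0 => //; rewrite nuE.
have [k rk Ek] := rep_cover 0%R.
rewrite (esumID [set k])//.
rewrite (_ : _ `&` [set k] = [set k]); last first.
  by apply/seteqP; split=> i [] // ->.
rewrite esum_set1//.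
rewrite [X in _ + X]esum1 => [|i [ri /= ik]]; last first.
  apply: nu0_zero; first exact: borel_shift.
  move=> x Ex /NE Exi; apply: ik; apply: rep_uniq => //.
  have -> : (e i - e k = (x + e i) - x + (0 - e k))%R by rewrite sub0r (addrC x) addrK.
  by apply: E0D => //; exact: E0B.
rewrite adde0; move: Ek => [h [r [Hh ek]]].
have -> : nu0 [set x | N0 (x + e k)%R] = nu0 N0.
  rewrite (_ : e k = j (- h) (- r))%R; last by rewrite jN// -ek sub0r opprK.
  by apply: nu0_shift => //; exact: H0N.
apply: (@le_lt_trans _ _ (mu C)); last by have [_ _ + _ _] := mu_Haar; exact.
apply: nu0_bound => //.
  by apply: closed_borel; exact: compact_closed.
move=> h' r' Hh' /interior_subset[v [r'' [Vv jE]]]; apply: VC.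
rewrite -(subrK v h'); apply: VD => //.
by apply: j_ker jE => //; exact: V_H0 Vv.
Qed.

Let nu_compact (K : set E) : compact K -> nu K < +oo.
Proof.
move=> cK; have [N0 [oN N00] nuN] := nu_small.
have [|x Kx|s sK] := @compact_finite_cover E E K (fun t => [set x | N0 (x - t)%R]) cK.
- by move=> t; exact: open_shift.
- by exists x => //=; rewrite subrr.
pose F (i : nat) : set (borel_space E) := [set x : E | N0 (x - nth 0%R s i)%R].
have mF i : measurable (F i) by apply: open_borel; exact: open_shift.
apply: (@le_lt_trans _ _ (\sum_(i < size s) nu (F i))).
  apply: content_subadditive => //.
    by apply: closed_borel; exact: compact_closed.
  move=> x /sK[t ts Nt]; rewrite -bigcup_mkord; exists (index t s).
    by rewrite /= index_mem.
  by rewrite /F /= nth_index.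
apply: lte_sum_pinfty => i _; rewrite /F.
by rewrite (nu_shift (- nth 0%R s i)%R (open_borel oN)).
Qed.

(** If [mu H0] were 0, each compact set, being covered by finitely many translates of the open set
    [H0], would be null, and by inner regularity so would [H]. *)
Let nu_nonzero : nu setT != 0%R.
Proof.
rewrite nuE gt_eqF//.
have r0 : coset_rep 0%N by [].
rewrite (esumID [set 0%N])//.
apply: (@lt_le_trans _ _ (mu H0)); last first.
  rewrite (_ : _ `&` [set 0%N] = [set 0%N]); last first.
    by apply/seteqP; split=> i [] // ->.
  rewrite esum_set1//.
  rewrite (_ : mkset _ = setT) ?nu0T; last by apply/seteqP.
  by rewrite leeDl//; apply: esum_ge0 => i _; exact: measure_ge0.
rewrite lt0e measure_ge0 andbT; apply/eqP => mu0.
have [+ _ _ _ inn] := mu_Haar; rewrite (inn setT openT) => /eqP; apply.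
apply/eqP; rewrite eq_le; apply/andP; split; last first.
  apply: ereal_sup_ubound; exists set0; last by rewrite measure0.
  by split=> //; exact: compact0.
apply: ge_ereal_sup => _ [K [cK _] <-].
have [|x Kx|s sK] := @compact_finite_cover H H K (fun t => [set x | H0 (x - t)%R]) cK.
- by move=> t; exact: open_shift.
- by exists x => //=; rewrite subrr.
pose F (i : nat) : set (borel_space H) := [set x : H | H0 (x - nth 0%R s i)%R].
have mF i : measurable (F i) by apply: open_borel; exact: open_shift.
apply: (@le_trans _ _ (\sum_(i < size s) mu (F i))).
  apply: content_subadditive => //.
    by apply: closed_borel; exact: compact_closed.
  move=> x /sK[t ts Nt]; rewrite -bigcup_mkord; exists (index t s).
    by rewrite /= index_mem.
  by rewrite /F /= nth_index.
rewrite big1// => i _; rewrite /F.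
by rewrite (mu_shift (- nth 0%R s i)%R (open_borel H0_open)).
Qed.

(** In the criterion for null sets [M] may vary with the coset, since [nu] is a sum over countably
    many cosets and each term is bounded by [mu M]. *)
Lemma Haar_extension : exists nu : {measure set (borel_space E) -> \bar R},
  Haar_measure nu /\
  forall A : set E, Borel A ->
    (forall x, exists M : set H, [/\ Borel M, mu M = 0%R &
       forall h r, H0 h -> A (j h r + x)%R -> M h]) -> nu A = 0%R.
Proof.
exists nu; split.
  have [b [c [bo cc bc bb]]] := lch_countable_basis hE lE sE.
  split.
  - exact: nu_nonzero.
  - exact: nu_invariant.
  - exact: nu_compact.
  - by move=> A bA; apply: (borel_outer_regular bo cc hE bc bb).
  - by move=> A oA; apply: (open_inner_regular cc hE bc bb).
move=> A bA An; rewrite nuE; apply: esum1 => k rk.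
have [M [bM M0 AM]] := An (e k).
apply/eqP; rewrite eq_le measure_ge0 andbT -M0.
by apply: nu0_bound => //; exact: borel_shift.
Qed.

End HaarExtension.

Lemma half_power_lt (R : realType) (e : R) : 0 < e -> exists n, 2^-1 ^+ n.+1 < e.
Proof.
move=> e0; exists (Num.bound e^-1); rewrite exprVn -[ltRHS]invrK ltf_pV2 ?posrE ?invr_gt0 ?exprn_gt0//.
apply: lt_trans (archi_boundP _) _; first by rewrite invr_ge0 ltW.
rewrite -natrX ltr_nat; have := @ltn_expl 2 (Num.bound e^-1).+1 isT.
exact: ltn_trans.
Qed.

(** * The new cut-and-project scheme *)

Section Construction.
Context {R : realType} {G H : topologicalZmodType}.
Variables (L : set (G * H)) (t : G) (chi : G -> R) (C V : nat -> set H).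
Local Notation H0 := (\bigcup_n C n).
Hypothesis L0 : L (0, 0).
Hypothesis LB : forall a b, L a -> L b -> L (a.1 - b.1, a.2 - b.2).
Hypothesis L_inj : forall a b, L a -> L b -> a.1 = b.1 -> a = b.
Hypothesis H0_open : open H0.
Hypothesis H00 : H0 0.
Hypothesis H0B : forall a b, H0 a -> H0 b -> H0 (a - b).
Hypothesis V_nbhs : forall n, nbhs (0 : H) (V n).
Hypothesis V_H0 : forall n, V n `<=` H0.
Hypothesis VN : forall n a, V n a -> V n (- a).
Hypothesis VD : forall n a b, V n.+1 a -> V n.+1 b -> V n (a + b).
Hypothesis chiD : forall a b, chi (a + b) = chi a + chi b.

Definition kern : set H := \bigcap_n V n.

(* All of [R] when the star map is injective modulo [kern], which makes the third
   coordinate collapse in the quotient. *)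
Definition periods (r : R) : Prop :=
  (exists q, [/\ L q, kern q.2 & q.1 != 0]) -> exists m : int, r = m%:~R.

Let H0N a : H0 a -> H0 (- a).
Proof. by move=> Ha; rewrite -sub0r; exact: H0B. Qed.

Let H0D a b : H0 a -> H0 b -> H0 (a + b).
Proof. by move=> Ha Hb; rewrite -[b]opprK; apply: H0B => //; exact: H0N. Qed.

Let V0 n : V n 0. Proof. exact: nbhs_singleton. Qed.

Let kern0 : kern 0. Proof. by move=> n _; exact: V0. Qed.

Let kernB a b : kern a -> kern b -> kern (a - b).
Proof. by move=> ka kb n _; apply: VD; [exact: ka|apply: VN; exact: kb]. Qed.

Let kernN a : kern a -> kern (- a).
Proof. by move=> ka; rewrite -sub0r; exact: kernB. Qed.

Let kern_H0 a : kern a -> H0 a.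
Proof. by move=> /(_ 0%N I); exact: V_H0. Qed.

Let periods_int (m : int) : periods m%:~R. Proof. by exists m. Qed.

Let periodsB r s : periods r -> periods s -> periods (r - s).
Proof.
by move=> pr ps q; have [m ->] := pr q; have [n ->] := ps q; exists (m - n); rewrite intrB.
Qed.

(** * The quotient group *)

Let total : set (H * int * R) := [set v | H0 v.1.1].
Let null : set (H * int * R) := [set v | [/\ H0 v.1.1, periods v.2 &
  exists l, [/\ L l, l.1 + t *~ v.1.2 = 0 & kern (v.1.1 - l.2)]]].
Let small n : set (H * int * R) :=
  [set v | [/\ V n v.1.1, v.1.2 = 0 & `|v.2| < 2^-1 ^+ n]].

Let nullB u v : null u -> null v -> null (u - v).
Proof.
move=> [Hu pu [k [Lk ku Ku]]] [Hv pv [l [Ll lv Kv]]]; split => /=.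
- exact: H0B.
- exact: periodsB.
- exists (k.1 - l.1, k.2 - l.2); split => /=; first exact: LB.
    by rewrite mulrzBr addrACA -opprD ku lv subr0.
  have -> : u.1.1 - v.1.1 - (k.2 - l.2) = (u.1.1 - k.2) - (v.1.1 - l.2).
    rewrite !opprB !addrA; do 2 rewrite [LHS]addrAC.
    by rewrite -!addrA; congr (_ + _); rewrite addrCA [RHS]addrC -!addrA.
  exact: kernB.
Qed.

Let small0 n : small n 0.
Proof. by split=> //=; rewrite normr0 exprn_gt0// invr_gt0. Qed.

Let smallN n v : small n v -> small n (- v).
Proof. by move=> [Vv v0 vr]; split=> /=; [exact: VN|rewrite v0 oppr0|rewrite normrN]. Qed.

Let smallD n u v : small n.+1 u -> small n.+1 v -> small n (u + v).
Proof.
move=> [Vu u0 ur] [Vv v0 vr]; split=> /=; [exact: VD|by rewrite u0 v0 addr0|].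
apply: le_lt_trans (ler_normD _ _) _.
by rewrite [ltRHS](_ : _ = 2^-1 ^+ n.+1 + 2^-1 ^+ n.+1) ?ltrD// exprS; field.
Qed.

Let total0 : total 0. Proof. exact: H00. Qed.
Let totalB u v : total u -> total v -> total (u - v). Proof. exact: H0B. Qed.
Let null0 : null 0.
Proof.
split=> //=; first exact: (periods_int 0).
by exists (0, 0); split=> //=; [rewrite mulr0z addr0|rewrite subrr].
Qed.
Let null_total : null `<=` total. Proof. by move=> v []. Qed.
Let small_total n : small n `<=` total. Proof. by move=> v [/V_H0]. Qed.

(** This says that [null] is closed. Small elements have integer coordinate 0, so [L_inj] forces the
    same [l] at every scale and [v.1.1 - l.2] lands in all [V n]. The real coordinate is a limit of
    integers, unless all reals are periods. *)
Let separated v : (forall n, exists2 u, small n u & null (v - u)) -> null v.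
Proof.
move=> Hv.
have [u0 [Vu0 u00 _] [/= Hvu0 _ [l [Ll lv _]]]] := Hv 0%N.
split.
- by rewrite -(subrK u0.1.1 v.1.1); apply: H0D => //; exact: V_H0 Vu0.
- move=> ex.
  have [u [_ _ su] [_ pu _]] := Hv 1%N; have [m /= mE] := pu ex.
  exists m; apply/eqP; rewrite -subr_eq0 -mE /= opprB addrCA subrr addr0.
  apply/negP => /negP un0.
  (* Here [v.2 - m%:~R = u.2] has absolute value below one half. Were it nonzero, a scale finer than
     [|u.2|] would give an integer [m'] at distance less than 1 from [m], hence equal to [m], a
     contradiction. *)
  have [N NE] : exists N, 2^-1 ^+ N.+1 < `|u.2|.
    by have [N ?] := @half_power_lt R `|u.2| ltac:(by rewrite normr_gt0); exists N.
  have [w [_ _ sw] [_ pw _]] := Hv N.+1; have [m' /= m'E] := pw ex.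
  have : m = m'.
    have hN : 2^-1 ^+ N.+1 <= 2^-1 :> R.
      by rewrite exprS ler_piMr ?invr_ge0// exprn_ile1// ?invr_ge0// invf_le1// ler1n.
    have : `|(m - m')%:~R| < 1 :> R.
      rewrite intrB -mE -m'E; rewrite expr1 in su.
      have -> : v.2 - u.2 - (v.2 - w.2) = w.2 - u.2 by ring.
      by apply: le_lt_trans (ler_normB _ _) _; lra.
    by rewrite -intr_norm -[1]/(1%:~R) ltr_int; lia.
  move=> mm; move: mE m'E; rewrite mm => <- /eqP.
  rewrite (inj_eq (addrI _)) (inj_eq oppr_inj) => /eqP wu.
  by rewrite wu in sw; have := lt_trans sw NE; rewrite ltxx.
- exists l; split=> //.
    by move: lv; rewrite u00 subr0.
  move=> n _; have [u [Vu u0' _] [_ _ [l' [Ll' lv' kv]]]] := Hv n.+1.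
  have ll : l' = l.
    by apply: L_inj => //; apply: (@addIr _ (t *~ v.1.2)); move: lv lv'; rewrite /= u00 u0' !subr0 => -> ->.
  rewrite ll in kv.
  have -> : v.1.1 - l.2 = (v.1.1 - u.1.1 - l.2) + u.1.1 by rewrite addrAC subrK.
  by apply: VD => //; exact: kv.
Qed.

Lemma quotient_exists : exists (E : topologicalZmodType) (q : H -> int -> R -> E),
  [/\ hausdorff_space E,
      forall h h' n n' r r', H0 h -> H0 h' ->
        q (h + h') (n + n') (r + r') = q h n r + q h' n' r',
      forall e, exists h n r, H0 h /\ q h n r = e,
      forall h h' n n' r r', H0 h -> H0 h' -> q h n r = q h' n' r' <->
        periods (r - r') /\
        exists l, [/\ L l, l.1 + t *~ (n - n') = 0 & kern (h - h' - l.2)] &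
      forall A, nbhs (0 : E) A <->
        exists n, forall v r, V n v -> `|r| < 2^-1 ^+ n -> A (q v 0 r)].
Proof.
have [E [p [hE pD psurj peq pn]]] := subquotient_topology (D := Subquotient total0 totalB null0 nullB
  null_total small_total small0 smallN smallD) separated.
exists E, (fun h n r => p (h, n, r)); split=> //.
- by move=> h h' n n' r r' Hh Hh'; rewrite -pD.
- by move=> e; have [[[h n] r] Hh e'] := psurj e; exists h, n, r.
- move=> h h' n n' r r' Hh Hh'; rewrite peq//; split=> [[/= _ ? ?]//|[? ?]].
  by split=> //=; exact: H0B.
- move=> A; rewrite pn; split=> -[n An]; exists n.
    by move=> v r Vv rn; apply: An.
  by move=> [[v m] r] [/= Vv -> rn]; exact: An.
Qed.

Variables (E : topologicalZmodType) (q : H -> int -> R -> E).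
Hypothesis hE : hausdorff_space E.
Hypothesis qD : forall h h' n n' r r', H0 h -> H0 h' ->
  q (h + h') (n + n') (r + r') = q h n r + q h' n' r'.
Hypothesis q_surj : forall e, exists h n r, H0 h /\ q h n r = e.
Hypothesis q_eq : forall h h' n n' r r', H0 h -> H0 h' -> q h n r = q h' n' r' <->
  periods (r - r') /\ exists l, [/\ L l, l.1 + t *~ (n - n') = 0 & kern (h - h' - l.2)].
Hypothesis q_nbhs : forall A, nbhs (0 : E) A <->
  exists n, forall v r, V n v -> `|r| < 2^-1 ^+ n -> A (q v 0 r).

(** * The new lattice and its star map *)

Definition new_lattice : set (G * E) := [set z | exists l m,
  [/\ L l, H0 l.2, z.1 = l.1 + t *~ m & z.2 = q l.2 m (chi z.1)]].

Let chi0 : chi 0 = 0.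
Proof. by apply: (@addrI _ (chi 0)); rewrite -chiD !addr0. Qed.

Let chiN a : chi (- a) = - chi a.
Proof. by apply: (@addrI _ (chi a)); rewrite -chiD !subrr chi0. Qed.

Let q0 : q 0 0 0 = 0.
Proof. by apply: (@addrI _ (q 0 0 0)); rewrite -qD// !addr0. Qed.

Let qN h n r : H0 h -> q (- h) (- n) (- r) = - q h n r.
Proof.
move=> Hh; apply: (@addrI _ (q h n r)).
by rewrite -qD ?subrr ?q0//; exact: H0N.
Qed.

Let qB h h' n n' r r' : H0 h -> H0 h' ->
  q (h - h') (n - n') (r - r') = q h n r - q h' n' r'.
Proof. by move=> Hh Hh'; rewrite qD ?qN//; exact: H0N. Qed.

Lemma new_lattice0 : new_lattice (0, 0).
Proof. by exists (0, 0), 0; split=> //=; rewrite ?mulr0z ?addr0 ?chi0 ?q0. Qed.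

Lemma new_latticeB a b : new_lattice a -> new_lattice b ->
  new_lattice (a.1 - b.1, a.2 - b.2).
Proof.
move=> [l [m [Ll Hl a1 a2]]] [k [n [Lk Hk b1 b2]]].
exists (l.1 - k.1, l.2 - k.2), (m - n); split=> /=.
- exact: LB.
- exact: H0B.
- by rewrite a1 b1 mulrzBr opprD addrACA.
- by rewrite a2 b2 chiD chiN qB.
Qed.

(** A point may be written as [l.1 + t *~ m] in several ways; the quotient kills the difference of
    the corresponding triples, so the star image does not depend on the choice. *)
Let new_lattice_fst0 z : new_lattice z -> z.1 = 0 -> z.2 = 0.
Proof.
move=> [l [m [Ll Hl z1 z2]]] z10; rewrite z2 z10 chi0 -q0; apply/q_eq => //.
split; first by rewrite subr0; exact: (periods_int 0).
by exists l; split=> //; [rewrite subr0 -z1|rewrite subr0 subrr].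
Qed.

Lemma new_lattice_inj a b : new_lattice a -> new_lattice b -> a.1 = b.1 -> a = b.
Proof.
move=> La Lb ab; have /= := new_lattice_fst0 (new_latticeB La Lb).
rewrite ab subrr => /(_ erefl)/eqP; rewrite subr_eq0 => /eqP ab2.
by rewrite [a]surjective_pairing [b]surjective_pairing ab ab2.
Qed.

Hypothesis chi_irr : forall l, L l -> kern l.2 -> l.1 != 0 ->
  forall m : int, chi l.1 != m%:~R.

(** A difference [g] with star image 0 is the first coordinate of a point of [L] whose second
    coordinate is in [kern], and [chi g] is a period. If [g] is nonzero, the periods are the
    integers, which [chi_irr] excludes. *)
Lemma new_star_injective : star_injective new_lattice.
Proof.
move=> a b La Lb ab; apply: new_lattice_inj => //.
have [l [m [Ll Hl /= z1 z2]]] := new_latticeB La Lb.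
move: z2; rewrite ab subrr => /esym; rewrite -q0 => /q_eq -[]// pchi [k [Lk k1 kk]].
apply/eqP; rewrite -subr_eq0; apply/negP => /negP g0.
have gE : a.1 - b.1 = (l.1 - k.1, l.2 - k.2).1.
  by rewrite z1 /=; congr (_ + _); apply/eqP; rewrite -addr_eq0 -k1 subr0 addrC.
have Lg := LB Ll Lk; rewrite subr0 in kk.
have [|m' m'E] := pchi; first by exists (l.1 - k.1, l.2 - k.2); split=> //; rewrite -gE.
have := chi_irr Lg kk; rewrite -gE => /(_ g0 m').
by rewrite -m'E subr0 eqxx.
Qed.

Variable P : set G.
Hypothesis P_nbhs : nbhs 0 P.
Hypothesis P_sep : forall l, L l -> P l.1 -> V 0%N l.2 -> l = (0, 0).

(** Modulo the relations, [z.1] is the first coordinate of a point of [L] whose second coordinate is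
    in [V 1 + kern], hence in [V 0]. *)
Let new_lattice_sep z : new_lattice z -> P z.1 ->
  (exists v r, V 1%N v /\ z.2 = q v 0 r) -> z = (0, 0).
Proof.
move=> Lz Pz [v [r [Vv z2']]]; have [l [m [Ll Hl z1 z2]]] := Lz.
apply: new_lattice_inj => //; first exact: new_lattice0.
move: z2'; rewrite z2 => /q_eq -[]//; first exact: V_H0 Vv.
move=> _ [k [Lk k1 kk]].
have zE : z.1 = l.1 - k.1.
  by rewrite z1; congr (_ + _); apply/eqP; rewrite -addr_eq0 -k1 subr0 addrC.
have Vlk : V 0%N (l.2 - k.2).
  rewrite -(subrK v l.2) addrAC; by apply: VD => //; exact: kk.
have /(_ _ _)/= := P_sep (LB Ll Lk); rewrite -zE => /(_ Pz Vlk)[-> _].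
by [].
Qed.

Lemma new_lattice_discrete l : new_lattice l ->
  exists N : set (G * E), nbhs l N /\ N `&` new_lattice = [set l].
Proof.
move=> Ll; pose Q : set E := [set x | exists v r, V 1%N v /\ x = q v 0 r].
have nQ : nbhs (0 : E) Q by apply/q_nbhs; exists 1%N => v r Vv _; exists v, r.
exists [set z | P (z.1 - l.1) /\ Q (z.2 - l.2)]; split.
  exists ([set x | P (x - l.1)], [set x | Q (x - l.2)]) => [|[]//] /=.
  by split; apply: nbhs_shift; rewrite subrr.
apply/seteqP; split=> [z [[Pz Qz] Lz]|_ ->] /=; last first.
  by split=> //; rewrite !subrr; split; exact: nbhs_singleton.
have := new_lattice_sep (new_latticeB Lz Ll) Pz Qz.
case=> /eqP; rewrite subr_eq0 => /eqP e1 /eqP; rewrite subr_eq0 => /eqP e2.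
by rewrite [z]surjective_pairing [l]surjective_pairing e1 e2.
Qed.

(** * Local compactness and cocompactness *)

Let q_nbhs_at h n r A : H0 h -> nbhs (q h n r) A ->
  nbhs ((h, r) : H * R) [set z | H0 z.1 /\ A (q z.1 n z.2)].
Proof.
move=> Hh /nbhs0_shift /q_nbhs [k Ak].
exists ([set z | V k (z - h)], [set s : R | `|r - s| < 2^-1 ^+ k]) => /=.
  split; first by apply: nbhs_shift; rewrite subrr.
  by apply/nbhs_ballP; exists (2^-1 ^+ k) => //=; rewrite exprn_gt0// invr_gt0.
move=> [h' s] /= [Vh rs].
have Hh' : H0 h' by rewrite -(subrK h h'); apply: H0D => //; exact: V_H0 Vh.
split=> //; rewrite (_ : q h' n s = q h n r + q (h' - h) 0 (s - r)).
  by apply: Ak => //; rewrite distrC.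
by rewrite -qD ?addr0 ?(addrC h) ?(addrC r) ?subrK//; exact: H0B.
Qed.

Let q_compact (K : set H) (I : set R) n : compact K -> K `<=` H0 -> compact I ->
  compact [set q z.1 n z.2 | z in K `*` I].
Proof.
move=> cK KH cI; apply: continuous_compact; last exact: compact_setX.
apply: continuous_in_subspaceT => -[h r]; rewrite inE => -[/= Kh Ir] A nA.
by apply: filterS (q_nbhs_at (KH _ Kh) nA) => z [].
Qed.

Variable Q : set H.
Hypothesis Q_compact : compact Q.
Hypothesis VQ : V 0%N `<=` Q.
Hypothesis QH : Q `<=` H0.

Lemma new_LCA : LCA E.
Proof.
split=> // e _.
have cQ := @q_compact Q _ 0 Q_compact QH (@segment_compact R (-1) 1).
set S := (X in compact X) in cQ.
have nS : nbhs (0 : E) S.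
  apply/q_nbhs; exists 0%N => v r Vv r1; exists (v, r) => //; split=> /=; first exact: VQ.
  by rewrite in_itv/= -ler_norml ltW.
exists [set y | S (y - e)].
  by rewrite withinET; apply: nbhs_shift; rewrite subrr.
have -> : [set y | S (y - e)] = [set y + e | y in S].
  apply/seteqP; split=> [y Sy|_ [y Sy <-]] /=; last by rewrite addrK.
  by exists (y - e) => //; rewrite subrK.
have cS : compact [set y + e | y in S].
  by apply: continuous_compact => //; apply: continuous_subspaceT => y; exact: shift_continuous.
by split=> //; exact: compact_closed.
Qed.

Variable K : set (G * H).
Hypothesis K_compact : compact K.
Hypothesis KH : forall k, K k -> H0 k.2.
Hypothesis K_cover : forall z : G * H, exists k l, K k /\ L l /\ z = (k.1 + l.1, k.2 + l.2).

Lemma new_lattice_cocompact : exists K' : set (G * E), compact K' /\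
  forall z : G * E, exists k l, K' k /\ new_lattice l /\ z = (k.1 + l.1, k.2 + l.2).
Proof.
exists [set (z.1.1, q z.1.2 0 z.2) | z in K `*` `[0, 1]%classic]; split.
  apply: continuous_compact; last by apply: compact_setX => //; exact: segment_compact.
  apply: continuous_in_subspaceT => -[[g h] r]; rewrite inE => -[/= Kk Ir].
  apply: cvg_pair => /=.
    move=> A nA; exists ([set z : G * H | A z.1], setT) => /=; last by move=> [[g' h'] r'] [].
    by split; [exact: cvg_fst nA|exact: filterT].
  move=> A nA; have [[A1 A2] /= [nA1 nA2] AA] := q_nbhs_at (KH Kk) nA.
  exists ([set z : G * H | A1 z.2], A2) => /=; first by split=> //; apply: cvg_snd nA1.
  by move=> [[g' h'] r'] /= [? ?]; have [] := AA (h', r').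
move=> [g e]; have [h [m [r [Hh <-]]]] := q_surj e.
(* Covering [(g - t *~ m, h)] rather than [(g, h)] moves the integer coordinate [m] into the lattice
   point; the real coordinate is reduced to [[0, 1]] by subtracting an integer period. *)
have [k [l [Kk [Ll [gE hE']]]]] := K_cover (g - t *~ m, h).
have Hl : H0 l.2.
  have -> : l.2 = h - k.2 by rewrite hE' addrAC subrr add0r.
  by apply: H0B => //; exact: KH.
pose g' := l.1 + t *~ m; pose s := r - chi g'.
exists (k.1, q k.2 0 (s - (Num.floor s)%:~R)), (g', q l.2 m (chi g')); split=> /=.
  exists (k, s - (Num.floor s)%:~R) => //; split=> //=.
  rewrite in_itv/= subr_ge0 floor_le /=.
  by have /andP[_ /ltW] := floor_itv s; rewrite intrD addrC -lerBlDr.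
split; first by exists l, m.
congr pair; first by rewrite /g' addrA -gE subrK.
rewrite -qD//; last exact: KH.
apply/q_eq => //; first by rewrite -hE'.
split.
  rewrite (_ : r - _ = (Num.floor s)%:~R); first exact: periods_int.
  by rewrite /s; ring.
exists (0, 0); split=> //=; first by rewrite !add0r subrr mulr0z.
by rewrite -hE' subrr subr0.
Qed.

(** * Density and second countability *)

Hypothesis L_dense : dense [set l.2 | l in L].
Hypothesis G_torsion_free : forall (g : G) (k : int), g != 0 -> k != 0 -> g *~ k != 0.

Let L_near h A : H0 h -> nbhs h A -> exists l, [/\ L l, H0 l.2 & A l.2].
Proof.
move=> Hh nA; have [||y [[Al Hl] [l Ll le]]] := L_dense (O := A° `&` H0).
- by exists h.
- by apply: openI => //; exact: open_interior.
- by exists l; rewrite le; split=> //; exact: interior_subset Al.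
Qed.

Let LZ l (k : int) : L l -> L (l.1 *~ k, l.2 *~ k).
Proof.
move=> Ll; have LN a : L a -> L (- a.1, - a.2) by move=> /(LB L0); rewrite /= !sub0r.
have LD a b : L a -> L b -> L (a.1 + b.1, a.2 + b.2).
  by move=> La /LN Lb; have := LB La Lb; rewrite /= !opprK.
have Ln (n : nat) : L (l.1 *+ n, l.2 *+ n).
  by elim: n => [|n IH]; rewrite ?mulr0n// !mulrS; exact: (LD l _ Ll IH).
by case: k => n; [exact: Ln|rewrite !NegzE !mulrNz; exact: LN (Ln n.+1)].
Qed.

Let kernZ a (k : int) : kern a -> kern (a *~ k).
Proof.
move=> ka; have kn (n : nat) : kern (a *+ n).
  elim: n => [|n IH]; rewrite ?mulr0n// mulrSr.
  by have := kernB IH (kernN ka); rewrite opprK.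
by case: k => n; [exact: kn|rewrite !NegzE !mulrNz; exact: kernN (kn n.+1)].
Qed.

Let chiZ g (k : int) : chi (g *~ k) = chi g *~ k.
Proof.
have chin (n : nat) : chi (g *+ n) = chi g *+ n.
  by elim: n => [|n IH]; rewrite ?mulr0n// !mulrS chiD IH.
by case: k => n; [exact: chin|rewrite !NegzE !mulrNz chiN; congr (- _); exact: chin].
Qed.

Let chi_dense l : L l -> kern l.2 -> l.1 != 0 ->
  forall r eps : R, 0 < eps -> exists k m : int, `|chi (l.1 *~ k) + m%:~R - r| < eps.
Proof.
move=> Ll kl l0 r eps eps0.
have [k m k0|k [m km]] := @multiples_dense_mod1 R (chi l.1) _ r eps eps0.
  by rewrite -chiZ; apply: (chi_irr (LZ k Ll) (kernZ k kl)); exact: G_torsion_free.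
by exists k, m; rewrite chiZ.
Qed.

(** Density of the projection of [L] settles the coordinate in [H]. Adding multiples of a lattice
    point [p] with [p.2] in [kern] does not change its class and shifts [chi] densely modulo 1. If
    no such [p] with [p.1 != 0] exists, every real is a period. *)
Lemma new_lattice_dense : dense [set l.2 | l in new_lattice].
Proof.
move=> A [e Ae] oA; have [h [m [r [Hh eE]]]] := q_surj e.
have := open_nbhs_nbhs (conj oA Ae); rewrite -eE => /nbhs0_shift /q_nbhs[k Ak].
have eps0 : 0 < 2^-1 ^+ k :> R by rewrite exprn_gt0// invr_gt0.
have [l [Ll Hl Vl]] : exists l, [/\ L l, H0 l.2 & V k (l.2 - h)].
  by apply: (@L_near h [set x | V k (x - h)]) => //; apply: nbhs_shift; rewrite subrr.
have [[p [Lp kp p0]]|np] := pselect (exists p, [/\ L p, kern p.2 & p.1 != 0]); last first.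
  exists (q l.2 m (chi (l.1 + t *~ m))); split; last first.
    by exists (l.1 + t *~ m, q l.2 m (chi (l.1 + t *~ m))) => //; exists l, m.
  rewrite (_ : q _ _ _ = q h m r + q (l.2 - h) 0 0).
    by apply: Ak => //; rewrite normr0.
  rewrite -qD//; last exact: H0B.
  rewrite !addr0 (addrC h) subrK; apply/q_eq => //; split; first by move=> ex; case: np.
  by exists (0, 0); split=> //=; rewrite ?subrr ?mulr0z ?addr0 ?subr0.
have [a [b ab]] := chi_dense Lp kp p0 (r - chi (l.1 + t *~ m)) eps0.
pose l' : G * H := (l.1 + p.1 *~ a, l.2 + p.2 *~ a).
have Ll' : L l'.
  have := LB Ll (LB L0 (LZ a Lp)); by rewrite /= !sub0r !opprK.
have Hl' : H0 l'.2 by apply: H0D => //; exact: kern_H0 (kernZ a kp).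
have chiE : chi (l'.1 + t *~ m) = chi (l.1 + t *~ m) + chi (p.1 *~ a).
  by rewrite -chiD /= addrAC.
exists (q l'.2 m (chi (l'.1 + t *~ m))); split; last first.
  by exists (l'.1 + t *~ m, q l'.2 m (chi (l'.1 + t *~ m))) => //; exists l', m.
rewrite (_ : q _ _ _ = q h m r + q (l.2 - h) 0 (chi (p.1 *~ a) + b%:~R - (r - chi (l.1 + t *~ m)))).
  exact: Ak.
rewrite -qD//; last exact: H0B.
rewrite addr0 (addrC h) subrK; apply/q_eq => //; split.
  rewrite chiE (_ : _ - _ = (- b)%:~R); first exact: periods_int.
  by rewrite intrN; ring.
exists (0, 0); split=> //=; rewrite ?subrr ?mulr0z ?addr0 ?subr0//.
by rewrite addrC addKr; exact: kernZ.
Qed.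

Lemma new_cut_and_project : LCA G -> cut_and_project new_lattice.
Proof.
move=> LG; split=> //; split; first exact: new_LCA.
split; first by split; [exact: new_lattice0|exact: new_latticeB].
split; first exact: new_lattice_discrete.
split; first exact: new_lattice_cocompact.
by split; [exact: new_lattice_inj|exact: new_lattice_dense].
Qed.

Hypothesis L_countable : countable [set l | L l /\ H0 l.2].

Let new_lattice_countable : countable new_lattice.
Proof.
have : countable ([set l | L l /\ H0 l.2] `*` [set: int]).
  by apply: countableX => //; exact: countableP.
move=> cX; apply: sub_countable cX.
pose f (z : G * H * int) : G * E :=
  (z.1.1 + t *~ z.2, q z.1.2 z.2 (chi (z.1.1 + t *~ z.2))).
apply: card_le_trans (card_image_le f _); apply: subset_card_le.
move=> z [l [m [Ll Hl z1 z2]]]; exists (l, m) => //.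
by rewrite /f /= [z]surjective_pairing z2 z1.
Qed.

Lemma new_second_countable : @second_countable E.
Proof.
pose b n : set E := [set x | exists v r, [/\ V n v, `|r| < 2^-1 ^+ n & x = q v 0 r]].
apply: (@dense_second_countable _ b [set l.2 | l in new_lattice]).
- by apply: card_le_trans new_lattice_countable; exact: card_image_le.
- exact: new_lattice_dense.
- by move=> n; apply/q_nbhs; exists n => v r Vv rn; exists v, r.
- by move=> A /q_nbhs[n An]; exists n => _ [v [r [Vv rn ->]]]; exact: An.
Qed.

(** * The new window *)

Variables (U W : set H) (Lam : set G).
Hypothesis UW : U `<=` W.
Hypothesis W_compact : compact W.
Hypothesis W_H0 : W `<=` H0.
Hypothesis Lam_inner : forall l, L l -> U l.2 -> Lam (t + l.1).
Hypothesis Lam_outer : forall g, Lam g -> exists l, [/\ L l, W l.2 & g = t + l.1].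

(** Unlike [U] in general, this set is invariant under [kern], and its image in [E] is open. *)
Definition core : set H := [set u | exists n, forall v, V n v -> U (u + v)].

(** The integer coordinate is 1 because the points of [Lam] have the form [t + l.1]. The countable
    second part supplies the points of [Lam] that the core misses. *)
Definition new_window : set E :=
  [set q u 1 r | u in core & r in [set: R]] `|` [set z.2 | z in new_lattice `&` [set z | Lam z.1]].

Let coreU : core `<=` U.
Proof. by move=> u [n Un]; rewrite -[u]addr0; apply: Un; exact: V0. Qed.

Let core_H0 : core `<=` H0.
Proof. by move=> u /coreU/UW/W_H0. Qed.

Let core_kern u k : core u -> kern k -> core (u + k).
Proof.
move=> [n Un] kk; exists n.+1 => v Vv; rewrite -addrA; apply: Un; apply: VD => //; exact: kk.
Qed.

Let open_core_image : open [set q u 1 r | u in core & r in [set: R]].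
Proof.
rewrite openE => _ [u cu [r _ <-]]; have [n Un] := cu.
apply/nbhs0_shift/q_nbhs; exists n.+1 => v s Vv _ /=.
exists (u + v); last first.
  by exists (r + s) => //; rewrite -qD ?addr0//; [exact: core_H0|exact: V_H0 Vv].
by exists n.+1 => w Vw; rewrite -addrA; apply: Un; exact: VD.
Qed.

Let outer_window : set E := [set q z.1 1 z.2 | z in W `*` `[0, 1]%classic].

Let outer_window_compact : compact outer_window.
Proof. by apply: q_compact => //; exact: segment_compact. Qed.

Let outer_windowE w r : W w -> outer_window (q w 1 r).
Proof.
move=> Ww; exists (w, r - (Num.floor r)%:~R).
  split=> //=; rewrite in_itv/= subr_ge0 floor_le /=.
  by have /andP[_ /ltW] := floor_itv r; rewrite intrD addrC -lerBlDr.
apply/q_eq => /=; try exact: W_H0.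
split.
  rewrite (_ : _ - r = (- Num.floor r)%:~R); first exact: periods_int.
  by rewrite intrN; ring.
by exists (0, 0); split=> //=; rewrite subrr ?mulr0z ?addr0 ?subr0.
Qed.

Let new_window_outer : new_window `<=` outer_window.
Proof.
move=> e [[u /coreU/UW Wu [r _ <-]]|[z [Lz Lamz] <-]]; first exact: outer_windowE.
have [l [Ll Wl zE]] := Lam_outer Lamz.
have -> : z = (z.1, q l.2 1 (chi z.1)).
  apply: new_lattice_inj => //; exists l, 1; split=> //=; first exact: W_H0.
  by rewrite mulr1z addrC.
exact: outer_windowE.
Qed.

Let closure_new_window : closure new_window `<=` outer_window.
Proof.
rewrite [closure _]closureE; apply: smallest_sub => //.
exact: compact_closed.
Qed.

Lemma new_window_precompact : precompact new_window.
Proof.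
rewrite precompactE; apply: subclosed_compact outer_window_compact closure_new_window.
exact: closed_closure.
Qed.

Lemma new_window_model : core !=set0 -> model_window new_window.
Proof.
move=> [u cu]; split; first exact: new_window_precompact.
- rewrite /Borel -[smallest _ _]/(@measurable _ (borel_space E)).
  apply: measurableU; first exact: open_borel.
  apply: countable_measurable.
    by move=> x; apply: closed_borel; apply: accessible_closed_set1; exact: hausdorff_accessible.
  apply: card_le_trans (card_image_le _ _) _.
  by apply: sub_countable new_lattice_countable; apply: subset_card_le => z [].
- exists (q u 1 0); apply: (@filterS _ _ _ [set q u 1 r | u in core & r in [set: R]]).
    by move=> x ?; left.
  by apply: open_nbhs_nbhs; split=> //; exists u => //; exists 0.
Qed.

(** By injectivity of the star map, the added countable set brings in no point outside [Lam]. A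
    lattice point over the core is [t + l.1] with [l] in [L] and [l.2] in the core, by invariance
    under [kern], so [Lam_inner] applies. *)
Lemma Lambda_new_window : Lam = Lambda new_lattice new_window (0, 0).
Proof.
apply/seteqP; split=> [g Lg|_ [z [Lz wz] <-]] /=.
  have [l [Ll Wl gE]] := Lam_outer Lg.
  exists (g, q l.2 1 (chi g)) => /=; last by rewrite add0r.
  have Lz : new_lattice (g, q l.2 1 (chi g)).
    by exists l, 1; split=> //=; [exact: W_H0|rewrite mulr1z addrC].
  by split=> //=; right; exists (g, q l.2 1 (chi g)); rewrite ?add0r.
rewrite add0r; rewrite /= add0r in wz.
case: wz => [[u cu [r _ uz]]|[z' [Lz' Lamz'] zz']]; last first.
  by rewrite -(new_star_injective Lz' Lz zz').
have [l [m [Ll Hl z1 z2]]] := Lz.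
move: uz; rewrite z2 => /esym /q_eq -[]//; first exact: core_H0.
move=> _ [k [Lk k1 kk]].
have Ulk : U (l.2 - k.2).
  apply: coreU; have := core_kern cu kk; congr core.
  by rewrite addrA [u + (l.2 - u)]addrC subrK.
have := Lam_inner (LB Ll Lk) Ulk; congr Lam => /=.
have kE : k.1 = t - t *~ m.
  by apply/eqP; rewrite -subr_eq0 opprB -k1 mulrzBr mulr1z.
by rewrite z1 kE opprB addrCA [t + _]addrC subrK.
Qed.

(** * The boundary of the new window *)

Section RegularWindow.
Variable mu : {measure set (borel_space H) -> \bar R}.
Hypothesis mu_Haar : Haar_measure mu.
Hypothesis hH : hausdorff_space H.
Variable M : set H.
Hypothesis M_borel : Borel M.
Hypothesis M_null : mu M = 0%E.
Hypothesis WM : forall h w, W w -> kern (h - w) -> ~ core h -> M h.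

(** The closure lies in the image of [W] and the interior contains that of the core, so on each
    coset the boundary pulls back into a translate of [M] or is empty. *)
Lemma new_window_regular : core !=set0 -> regular_window R new_window.
Proof.
move=> c0; split; first exact: new_window_model.
have [f fP] := countable_enum L_countable (conj L0 H00 : [set l | L l /\ H0 l.2] (0, 0)).
pose e (k : nat) : E := q 0 (odflt 0 (unpickle k)) 0.
have [||||||nu [nu_Haar nu0]] := @Haar_extension R H E H0 V (fun h r => q h 0 r)
  H0_open H00 H0B V_nbhs V_H0 VN VD _ _ _ _ hE new_LCA.2 new_second_countable
  (fun k => (f k).2) e _ _ mu mu_Haar Q Q_compact VQ hH.
- by move=> h h' r r' Hh Hh'; rewrite -qD// addr0.
- rewrite -q0; apply/q_eq => //; split; first by rewrite subr0; exact: (periods_int 1).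
  by exists (0, 0); split=> //=; rewrite ?subrr ?mulr0z ?addr0 ?subr0.
- move=> A; exact: q_nbhs.
- move=> h h' r r' n Hh Hh' /q_eq -[]// _ [l [Ll l1 kl]].
  have l0 : l = (0, 0) by apply: L_inj => //=; rewrite -l1 subrr mulr0z addr0.
  by have := kl n I; rewrite l0 subr0.
- move=> h A Hh nA; have [l [Ll Hl Al]] := L_near Hh nA.
  by have [k fk] := fP l (conj Ll Hl); exists k; rewrite fk.
- move=> x; have [h [n [r [Hh <-]]]] := q_surj x.
  exists (pickle n), h, r; split=> //.
  by rewrite /e pickleK /= -qD// !add0r addr0.
exists nu; split=> //; apply: nu0.
  rewrite /Borel -[smallest _ _]/(@measurable _ (borel_space E)).
  by apply: measurableD; [apply: closed_borel; exact: closed_closure|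
    apply: open_borel; exact: open_interior].
move=> x; have [h0 [n [r0 [Hh0 <-]]]] := q_surj x.
(* The window lives at integer coordinate 1. A coset of coordinate [n] can meet it only if
   [t *~ (n - 1)] comes from a lattice point over [H0]. *)
have [[k [Lk Hk k1]]|nk] := pselect (exists k, [/\ L k, H0 k.2 & k.1 + t *~ (n - 1) = 0]); last first.
  exists set0; split; [exact: open_borel open0|exact: measure0|].
  move=> h r Hh [/closure_new_window [[w r'] [/= Ww _]]]; rewrite -qD//.
  move=> /q_eq -[]; [exact: W_H0|exact: H0D|].
  move=> _ [l [Ll l1 kl]] _; apply: nk.
  exists (0 - l.1, 0 - l.2); split=> /=; first exact: LB L0 Ll.
    rewrite sub0r; apply: H0N.
    have -> : l.2 = w - (h + h0) - (w - (h + h0) - l.2) by rewrite opprB addrCA subrr addr0.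
    apply: H0B; last exact: kern_H0.
    by apply: H0B; [exact: W_H0|exact: H0D].
  by rewrite add0r in l1; rewrite sub0r -(opprB 1 n) mulrNz -opprD l1 oppr0.
exists [set h | M (h + (h0 - k.2))]; split.
- exact: borel_shift.
- have [_ inv _ _ _] := mu_Haar.
  by rewrite -M_null -(inv (- (h0 - k.2)) M M_borel) image_shift opprK.
move=> h r Hh [/closure_new_window [[w r'] [/= Ww _]]]; rewrite -qD// => eq nW.
have [] // := (q_eq 1 (0 + n) r' (r + r0) (W_H0 Ww) (H0D Hh Hh0)).1 eq.
move=> _ [l [Ll l1 kl]].
have lk : l = (0 - k.1, 0 - k.2).
  apply: L_inj => //=; first exact: LB L0 Lk.
  apply: (@addIr _ (t *~ (1 - (0 + n)))).
  by rewrite l1 !add0r -(opprB n 1) mulrNz -opprD k1 oppr0.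
apply: (WM Ww).
  have := kernN kl; congr kern.
  by rewrite lk /= sub0r opprK opprD opprB [in RHS]addrA [RHS]addrAC.
move=> cc; apply: nW.
apply: (@filterS _ _ _ [set q u 1 r | u in core & r in [set: R]]).
  by move=> y ?; left.
apply: open_nbhs_nbhs; split=> //; exists (h + (h0 - k.2)) => //; exists (r + r0) => //.
apply/q_eq; [exact: core_H0|exact: H0D|].
split; first by rewrite subrr; exact: (periods_int 0).
exists l; split=> //.
rewrite lk /= sub0r opprK [h + (h0 - k.2)]addrA -[_ + k.2]addrA.
by rewrite [- (h + h0) + k.2]addrC addrA subrK subrr.
Qed.

End RegularWindow.

Lemma new_scheme : LCA G -> hausdorff_space H -> core !=set0 ->
  [/\ cut_and_project new_lattice, @second_countable E, star_injective new_lattice,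
      model_window new_window & Lam = Lambda new_lattice new_window (0, 0)] /\
  forall (mu : {measure set (borel_space H) -> \bar R}) (M : set H),
    Haar_measure mu -> Borel M -> mu M = 0%E ->
    (forall h w, W w -> kern (h - w) -> ~ core h -> M h) -> regular_window R new_window.
Proof.
move=> LG hH c0; split; first split.
- exact: new_cut_and_project.
- exact: new_second_countable.
- exact: new_star_injective.
- exact: new_window_model.
- exact: Lambda_new_window.
- by move=> mu M mu_Haar bM M0 WM; apply: (new_window_regular mu_Haar) WM _.
Qed.

End Construction.

(** * Choice of the neighbourhoods and conclusion *)

(** Up to null sets, [W] is a countable intersection of open sets and, by the next lemma, [U] a
    countable union of compact ones; these sets will dictate the choice of the [V n]. *)
Lemma Haar_outer_null (R : realType) (H : topologicalZmodType)
    (mu : {measure set (borel_space H) -> \bar R}) (W : set H) :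
    hausdorff_space H -> Haar_measure mu -> compact W ->
  exists A : nat -> set H, [/\ forall n, open (A n), forall n, W `<=` A n &
    mu ((\bigcap_n A n) `\` W) = 0%E].
Proof.
move=> hH [_ _ fin out _] cW; have bW : Borel W by apply: closed_borel; exact: compact_closed.
have finW : mu W \is a fin_num by rewrite ge0_fin_numE//; exact: fin.
have /choice[A AP] : forall n, exists A : set H,
    [/\ open A, W `<=` A & (mu A < mu W + n.+1%:R^-1%:E)%E].
  move=> n; have e0 : 0 < n.+1%:R^-1 :> R by rewrite invr_gt0.
  rewrite (out W bW) in finW *.
  by have [_ [A [oA WA] <-] mA] := lb_ereal_inf_adherent e0 finW; exists A.
exists A; split=> [n|n|]; [by have [] := AP n|by have [] := AP n|].
have bA n : Borel (A n) by have [oA _ _] := AP n; exact: open_borel.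
have bI : Borel (\bigcap_n A n) by apply: (@bigcap_measurable _ (borel_space H)) => // n _; exact: bA.
have WI : W `<=` \bigcap_n A n by move=> w Ww n _; have [_ WA _] := AP n; exact: WA.
have bD : Borel ((\bigcap_n A n) `\` W) by exact: borelD.
apply/eqP; rewrite eq_le measure_ge0 andbT; apply/lee_addgt0Pr => e e0; rewrite add0e.
have [n ne] : exists n, n.+1%:R^-1 < e.
  exists (Num.bound e^-1); rewrite -[ltRHS]invrK ltf_pV2 ?posrE ?invr_gt0//.
  apply: lt_trans (archi_boundP _) _; first by rewrite invr_ge0 ltW.
  by rewrite ltr_nat.
rewrite -(leeD2lE _ _ finW) -measureU//; last by rewrite setDE setICA setICr setI0.
rewrite setDUK//; apply: (@le_trans _ _ (mu (A n))).
  apply: le_measure; rewrite ?inE; [exact: bI|exact: bA|by move=> h; apply].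
have [_ _ /ltW mA] := AP n; apply: le_trans mA _; rewrite leeD2lE// lee_fin; exact: ltW.
Qed.

Lemma Haar_inner_null (R : realType) (H : topologicalZmodType)
    (mu : {measure set (borel_space H) -> \bar R}) (U : set H) :
    hausdorff_space H -> Haar_measure mu -> open U -> (mu U < +oo)%E ->
  exists C : nat -> set H, [/\ forall n, compact (C n), forall n, C n `<=` U &
    mu (U `\` \bigcup_n C n) = 0%E].
Proof.
move=> hH [_ _ _ _ inn] oU ltyU; have bU : Borel U by exact: open_borel.
have finU : mu U \is a fin_num by rewrite ge0_fin_numE.
have /choice[C CP] : forall n, exists C : set H,
    [/\ compact C, C `<=` U & (mu U - n.+1%:R^-1%:E < mu C)%E].
  move=> n; have e0 : 0 < n.+1%:R^-1 :> R by rewrite invr_gt0.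
  rewrite (inn U oU) in finU *.
  by have [_ [C [cC CU] <-] mC] := ub_ereal_sup_adherent e0 finU; exists C.
exists C; split=> [n|n|]; [by have [] := CP n|by have [] := CP n|].
have bC n : Borel (C n).
  by have [cC _ _] := CP n; apply: closed_borel; exact: compact_closed.
have bI : Borel (\bigcup_n C n) by apply: (@bigcupT_measurable _ (borel_space H)) => n; exact: bC.
have bD : Borel (U `\` \bigcup_n C n) by exact: borelD.
apply/eqP; rewrite eq_le measure_ge0 andbT; apply/lee_addgt0Pr => e e0; rewrite add0e.
have [n ne] : exists n, n.+1%:R^-1 < e.
  exists (Num.bound e^-1); rewrite -[ltRHS]invrK ltf_pV2 ?posrE ?invr_gt0//.
  apply: lt_trans (archi_boundP _) _; first by rewrite invr_ge0 ltW.
  by rewrite ltr_nat.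
have [_ CU mC] := CP n.
have finC : mu (C n) \is a fin_num.
  rewrite ge0_fin_numE//; apply: (@le_lt_trans _ _ (mu U)) => //.
  by apply: le_measure; rewrite ?inE; [exact: bC|exact: bU|exact: CU].
apply: (@le_trans _ _ (mu (U `\` C n))).
  apply: le_measure; rewrite ?inE//; first exact: borelD.
  by apply: setDS => x Cx; exists n.
have bDn : Borel (U `\` C n) by exact: borelD.
rewrite -(leeD2lE _ _ finC) -measureU//; last by rewrite setDE setICA setICr setI0.
rewrite setDUK//; rewrite -leeBlDr//; apply/ltW; apply: le_lt_trans mC.
  by rewrite leeB// lee_fin ltW.
exact: bC.
Qed.

Lemma rV_torsion_free (R : realType) d (g : 'rV[R]_d) (k : int) :
  g != 0 -> k != 0 -> g *~ k != 0.
Proof.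
by move=> g0 k0; rewrite -scaler_int scaler_eq0 intr_eq0 negb_or k0.
Qed.

Lemma LCA_compact_nbhs (H : topologicalZmodType) : LCA H ->
  exists A : set H, compact A /\ nbhs (0 : H) A.
Proof.
by move=> [_ /(_ 0 I)[A nA [cA _]]]; exists A; rewrite withinET in nA.
Qed.

Section Main.
Context {R : realType} {d : nat} {H : topologicalZmodType}.
Variables (L : set ('rV[R]_d * H)) (x : 'rV[R]_d * H) (U W : set H) (Lam : set 'rV[R]_d).
Hypothesis HL : cut_and_project L.
Hypothesis U_open : open U.
Hypothesis U0 : U !=set0.
Hypothesis W_compact : compact W.
Hypothesis UW : U `<=` W.
Hypothesis Lam_inner : Lambda L U x `<=` Lam.
Hypothesis Lam_outer : Lam `<=` Lambda L W x.

Let U1 : set H := [set h | U (h + x.2)].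
Let W1 : set H := [set h | W (h + x.2)].

Let W1_compact : compact W1.
Proof.
rewrite (_ : W1 = [set h - x.2 | h in W]); last first.
  apply/seteqP; split=> [h Wh|_ [h Wh <-]]; last by rewrite /W1 /= subrK.
  by exists (h + x.2) => //; rewrite addrK.
apply: continuous_compact => //; apply: continuous_subspaceT => h.
exact: shift_continuous.
Qed.

Let U1_open : open U1. Proof. exact: open_shift. Qed.

(** The sequence [N] is a free parameter that the chain of the construction refines. That chain is
    not exposed, so the regularity clause asks for [M] to work for every sequence below [N]. *)
Lemma scheme_exists (N : nat -> set H) : (forall n, nbhs (0 : H) (N n)) ->
  exists (H' : topologicalZmodType) (L' : set ('rV[R]_d * H')) (W' : set H'),
    [/\ cut_and_project L', @second_countable H', star_injective L',
        model_window W' & Lam = Lambda L' W' (0, 0)] /\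
    forall (mu : {measure set (borel_space H) -> \bar R}) (M : set H),
      Haar_measure mu -> Borel M -> mu M = 0%E ->
      (forall V : nat -> set H, (forall n, V n `<=` N n) ->
        forall h w, W1 w -> kern V (h - w) -> ~ core V U1 h -> M h) ->
      regular_window R W'.
Proof.
move=> nN.
have [LG [LH [[L0 LB] [Ldisc [[K [cK Kcov]] [L_inj L_dense]]]]]] := HL.
have [A [cA nA]] := LCA_compact_nbhs LH.
(* Since [Q] will generate [H0], it collects a compact neighbourhood of 0, the window and the
   projection of [K]. *)
pose Q := A `|` (W1 `|` [set k.2 | k in K]).
have cQ : compact Q.
  apply: compactU => //; apply: compactU => //.
  by apply: continuous_compact => //; apply: continuous_subspaceT => z; exact: cvg_snd.
have nQ : nbhs (0 : H) Q by apply: filterS nA => a; left.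
have [C [cC QC oC CB]] := sigma_compact_subgroup cQ nQ.
have QH : Q `<=` \bigcup_n C n by move=> a /QC Ca; exists 0%N.
have H00 : (\bigcup_n C n) 0 by apply: QH; exact: nbhs_singleton.
have [D [nD DL]] := Ldisc _ L0.
have [[P Q0] /= [nP nQ0] PQ] := nD.
have [u0 Uu0] := U0.
pose u := u0 - x.2.
have U1u : U1 u by rewrite /U1 /= /u subrK.
(* The sets [V n] must also lie in the compact set [Q], separate the points of [L], and satisfy
   [u + V n] inside [U1], which puts [u] in the core. *)
pose N' n := N n `&` (Q `&` (Q0 `&` [set v | U1 (u + v)])).
have nN' n : nbhs (0 : H) (N' n).
  apply: filterI => //; apply: filterI => //; apply: filterI => //.
  by apply/(nbhs0_shift u U1); exact: open_nbhs_nbhs.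
have [V [nV VN' VN VD]] := nbhs_chain nN'.
have VQ n : V n `<=` Q by move=> v /VN'[_ []].
have DL' : D `&` L `<=` [set (0, 0)] by rewrite DL.
have cL := discrete_subgroup_countable_cut LB nD DL' cC.
have cL1 : countable [set l.1 | l in [set l | L l /\ (\bigcup_n C n) l.2]].
  by apply: card_le_trans cL; exact: card_image_le.
have [a aP] := generic_powers_form cL1.
have VH n : V n `<=` \bigcup_n0 C n0 by move=> v /VQ/QH.
have [E [q [hE qD qs qe qn]]] := @quotient_exists R _ _ L x.1 C V L0 LB L_inj H00 CB nV VH VN VD.
have chi_irr l : L l -> kern V l.2 -> l.1 != 0 -> forall m : int, powers_form a l.1 != m%:~R.
  move=> Ll kl; apply: aP; exists l => //; split=> //.
  by apply: VH (kl 0%N I).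
have P_sep l : L l -> P l.1 -> V 0%N l.2 -> l = (0, 0).
  by move=> Ll Pl /VN'[_ [_ [Ql _]]]; apply: DL'; split=> //; exact: PQ.
have KH k : K k -> (\bigcup_n C n) k.2 by move=> Kk; apply: QH; right; right; exists k.
have W1H : W1 `<=` \bigcup_n C n by move=> w Ww; apply: QH; right; left.
have [||||sch reg] := @new_scheme R _ H L x.1 (powers_form a) C V L0 LB L_inj oC H00 CB nV VH VN VD
  (@powers_formD _ _ a) E q hE qD qs qe qn chi_irr P nP P_sep Q cQ (VQ 0%N) QH K cK KH Kcov
  L_dense (@rV_torsion_free R d) cL U1 W1 Lam _ W1_compact W1H _ _ LG LH.1.
- by move=> h /UW.
- move=> l Ll Ul; apply: Lam_inner; exists l => //; split=> //.
  by rewrite addrC.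
- move=> g /Lam_outer[l [Ll Wl] <-]; exists l; split=> //.
  by rewrite /W1 /= addrC.
- by exists u, 0%N => v /VN'[_ [_ []]].
exists E, (new_lattice L x.1 (powers_form a) C q), (new_window L x.1 (powers_form a) C V q U1 Lam).
split=> // mu M mH bM M0 MV; apply: reg mH bM M0 _.
by apply: MV => n v /VN'[].
Qed.

Lemma regular_scheme_exists : Haar_null R (W `\` U) ->
  exists (H' : topologicalZmodType) (L' : set ('rV[R]_d * H')) (W' : set H'),
    [/\ cut_and_project L', @second_countable H', star_injective L',
        regular_window R W' & Lam = Lambda L' W' (0, 0)].
Proof.
move=> [mu [mH WU0]]; have [_ [LH _]] := HL; have hH := LH.1.
have [_ inv fin _ _] := mH.
have bW1 : Borel W1 by apply: closed_borel; exact: compact_closed.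
have bU1 : Borel U1 by exact: open_borel.
have bWU : Borel (W `\` U).
  apply: borelD; last exact: open_borel.
  by apply: closed_borel; exact: compact_closed.
have WU1 : mu (W1 `\` U1) = 0%E.
  by rewrite -WU0 -(inv (- x.2) _ bWU) image_shift opprK.
have UW1 : U1 `<=` W1 by move=> h /UW.
have finU : (mu U1 < +oo)%E.
  by apply: le_lt_trans (fin _ W1_compact); apply: le_measure; rewrite ?inE.
have [A [oA WA A0]] := Haar_outer_null hH mH W1_compact.
have [C [cC CU C0]] := Haar_inner_null hH mH U1_open finU.
have bA : Borel (\bigcap_n A n).
  by apply: (@bigcap_measurable _ (borel_space H)) => // n _; exact: open_borel.
have bC : Borel (\bigcup_n C n).
  apply: (@bigcupT_measurable _ (borel_space H)) => n; apply: closed_borel.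
  exact: compact_closed.
(* With these tubes [W1 + kern] lies in every [A n], and every [C n] lies in the core. *)
pose N n := [set v | forall c, C n c -> U1 (c + v)] `&` [set v | forall w, W1 w -> A n (w + v)].
have nN n : nbhs (0 : H) (N n) by apply: filterI; exact: compact_tube.
have [H' [L' [W' [[L'cp sc si mw LamE] reg]]]] := scheme_exists nN.
exists H', L', W'; split=> //.
pose M := (\bigcap_n A n) `\` (\bigcup_n C n).
apply: (reg mu M) => //; first exact: borelD.
  have bAW : Borel ((\bigcap_n A n) `\` W1) by exact: borelD.
  have bWU1 : Borel (W1 `\` U1) by exact: borelD.
  have bUC : Borel (U1 `\` \bigcup_n C n) by exact: borelD.
  apply: (@subset_measure0 _ _ _ mu _
    (((\bigcap_n A n) `\` W1) `|` ((W1 `\` U1) `|` (U1 `\` \bigcup_n C n)))).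
  - exact: borelD.
  - by apply: measurableU => //; exact: measurableU.
  - move=> h [Ah nC]; have [Wh|nW] := pselect (W1 h); last by left.
    by right; have [Uh|nU] := pselect (U1 h); [right|left].
  - have WC0 : mu ((W1 `\` U1) `|` (U1 `\` \bigcup_n C n)) = 0%E.
      exact: etrans (@measureU0 _ (borel_space H) R mu _ _ bWU1 bUC C0) WU1.
    have bWC := @measurableU _ (borel_space H) _ _ bWU1 bUC.
    exact: etrans (@measureU0 _ (borel_space H) R mu _ _ bAW bWC WC0) A0.
move=> V VN h w Ww kw nc; split=> [n _|[n _ Cn]].
  by have [_ /(_ w Ww)] := VN n _ (kw n I); rewrite addrC subrK.
by apply: nc; exists n => v /VN[Un _]; exact: Un.
Qed.

End Main.

Theorem theorem2p9 (R : realType) (d : nat) (H : topologicalZmodType)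
  (L : set ('rV[R]_d * H)) (x : 'rV[R]_d * H) (U W : set H)
  (Lam : set 'rV[R]_d) :
  cut_and_project L -> open U -> U !=set0 -> compact W -> U `<=` W ->
  Lambda L U x `<=` Lam -> Lam `<=` Lambda L W x ->
  (exists (H' : topologicalZmodType) (L' : set ('rV[R]_d * H')) (W' : set H'),
     [/\ cut_and_project L', @second_countable H', star_injective L',
         model_window W' & Lam = Lambda L' W' (0, 0)]) /\
  (Haar_null R (W `\` U) ->
   exists (H' : topologicalZmodType) (L' : set ('rV[R]_d * H')) (W' : set H'),
     [/\ cut_and_project L', @second_countable H', star_injective L',
         regular_window R W' & Lam = Lambda L' W' (0, 0)]) /\
  (* in particular: translates of inter (regular) model sets in R^d *)
  (forall (Gam : set 'rV[R]_d) (t : 'rV[R]_d),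
     is_inter_model_set Gam -> is_model_set [set t + g | g in Gam]) /\
  (forall (Gam : set 'rV[R]_d) (t : 'rV[R]_d),
     is_inter_regular_model_set R Gam ->
     is_regular_model_set R [set t + g | g in Gam]).
Proof.
move=> HL oU U0 cW UW LU LW; split; last split; last split.
- have [H' [L' [W' [+ _]]]] := scheme_exists HL oU U0 cW UW LU LW (fun _ => filterT).
  by exists H', L', W'.
- by move=> WU0; apply: (regular_scheme_exists HL oU U0 cW UW LU LW WU0).
- move=> Gam t [H1 [L1 [W1 [HL1 [pW bW W0] inn out]]]].
  (* The translation is absorbed by the base point [(t, 0)]. *)
  have [|||||H' [L' [W' [[? ? ? ? ?] _]]]] := @scheme_exists R d H1 L1 (t, 0) W1° (closure W1)
    [set t + g | g in Gam] HL1 _ W0 _ _ _ _ (fun _ => setT) (fun _ => filterT).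
  + exact: open_interior.
  + by rewrite -precompactE.
  + by apply: subset_trans (@subset_closure _ W1); exact: interior_subset.
  + move=> _ [l [Ll Wl] <-]; exists l.1 => //; apply: inn; exists l => //=.
    by rewrite add0r.
  + move=> _ [g /out [l [Ll Wl] <-] <-]; exists l => //=.
    by rewrite add0r.
  + by exists H', L', W'.
- move=> Gam t [H1 [L1 [W1 [HL1 [[pW bW W0] W1n] inn out]]]].
  (* With the interior and the closure as inner and outer windows, their difference is the boundary,
     null by assumption. *)
  have [|||||H' [L' [W' [? ? ? ? ?]]]] := @regular_scheme_exists R d H1 L1 (t, 0) W1° (closure W1)
    [set t + g | g in Gam] HL1 _ W0 _ _ _ _ W1n.
  + exact: open_interior.
  + by rewrite -precompactE.
  + by apply: subset_trans (@subset_closure _ W1); exact: interior_subset.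
  + move=> _ [l [Ll Wl] <-]; exists l.1 => //; apply: inn; exists l => //=.
    by rewrite add0r.
  + move=> _ [g /out [l [Ll Wl] <-] <-]; exists l => //=.
    by rewrite add0r.
  + by exists H', L', W'.
Qed.
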